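(* Let $\mathsf{M}$ be a loopless and coloopless Schubert matroid on $[n]$ of rank $r$ with defining set $U$. Then there exists a subdivision $\mathcal{S}$ of the base polytope $\mathscr{P}(\mathsf{M})$ into base polytopes of matroids, each of which is a direct sum of series-parallel matroids (with the maximal cells being base polytopes of series-parallel matroids), together with a bijection $\varphi$ between the set $\mathcal{S}^{\circ}$ of internal faces of $\mathcal{S}$ and the set of admissible Delannoy paths associated to $\mathsf{M}$, such that: (i) the facets (maximal cells) of $\mathcal{S}$ correspond under $\varphi$ exactly to the admissible Delannoy paths with no diagonal steps; (ii) more generally, for each matroid $\mathsf{N}$ whose base polytope is an internal face of $\mathcal{S}$, the number $c(\mathsf{N})$ of connected components of $\mathsf{N}$ satisfies that $c(\mathsf{N})-1$ equals the number of diagonal steps of the Delannoy path $\varphi(\mathscr{P}(\mathsf{N}))$.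
   Context: Schubert matroid: for $0\le r\le n$ and an $r$-subset $U\subseteq[n]$, order $r$-subsets by $I=\{i_1<\dots<i_r\}\le J=\{j_1<\dots<j_r\}$ iff $i_\ell\le j_\ell$ for all $\ell$; the Schubert matroid with defining set $U$ is the matroid on $[n]$ whose bases are the $r$-subsets $B$ with $U\le B$. For $P=\{p_1<\dots<p_r\}\subseteq[n]$, $\mathrm{path}(P)$ is the lattice path from $(0,0)$ to $(n-r,r)$ with $n$ unit steps whose $k$-th step is north $+(0,1)$ if $k\in P$ and east $+(1,0)$ otherwise. The lattice path representation of $\mathsf{M}$ is the region between $\mathrm{path}(U)$ (upper boundary) and $\mathrm{path}(\{n-r+1,\dots,n\})$ (lower boundary); the bases correspond to the paths in this region. An admissible Delannoy path associated to $\mathsf{M}$ is a lattice path from $(1,1)$ to $(n-r,r)$ using steps $+(1,0)$ (east), $+(0,1)$ (north) and $+(1,1)$ (diagonal) such that: (i) it stays within the lattice path representation of $\mathsf{M}$ (never above $\mathrm{path}(U)$); (ii) a north step is allowed only if the unit vertical segment it traverses is not a (vertical) step of $\mathrm{path}(U)$; (iii) a diagonal step from a point is allowed only when a north step from that point would be allowed. The base polytope $\mathscr{P}(\mathsf{N})$ of a matroid $\mathsf{N}$ on $E$ is the convex hull of the indicator vectors of its bases in $\mathbb{R}^E$. A matroid subdivision of $\mathscr{P}(\mathsf{M})$ is a polyhedral subdivision all of whose cells are base polytopes of matroids; internal faces are the cells not contained in the boundary of $\mathscr{P}(\mathsf{M})$. A series-parallel matroid is a matroid obtained from $\mathsf{U}_{0,1}$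 or $\mathsf{U}_{1,1}$ by a sequence of series and parallel extensions (equivalently, the single loop, the single coloop, or a matroid with $\beta$-invariant $1$). *)

(* Defs.v *)
From mathcomp Require Import all_boot all_order all_algebra zify.
Set Implicit Arguments.
Unset Strict Implicit.
Unset Printing Implicit Defensive.

Section Matroids.
Variable T : finType.

(* The ground set is a subset of [T], so that extensions and direct summands
   of matroids all live over the same label type. *)
Record matroid := Matroid {
  ground : {set T};
  bases : {set {set T}};
  bases_ground : forall B, B \in bases -> B \subset ground;
  bases_neq0 : bases != set0;
  bases_exchange : forall A B, A \in bases -> B \in bases ->
    forall x, x \in A :\: B ->
    exists2 y, y \in B :\: A & y |: (A :\ x) \in bases }.

Implicit Types M N : matroid.

Lemma bases_card M A B : A \in bases M -> B \in bases M -> #|A| = #|B|.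
Proof.
wlog suff le : A B / A \in bases M -> B \in bases M -> #|A| <= #|B|.
  by move=> hA hB; apply/eqP; rewrite eqn_leq !le.
move=> hA hB; move: {2}#|_| (leqnn #|A :\: B|) => k.
elim: k A hA => [|k IH] A hA.
  by rewrite leqn0 cards_eq0 setD_eq0 => /subset_leq_card.
have [/eqP|[x xAB]] := set_0Vmem (A :\: B).
  by rewrite setD_eq0 => /subset_leq_card.
move=> hk; have [y yBA hA'] := bases_exchange hA hB xAB.
move: xAB yBA; rewrite !inE => /andP[xB xA] /andP[yA yB].
have cA : #|y |: A :\ x| = #|A|.
  by rewrite cardsU1 !inE (negPf yA) andbF /= (cardsD1 x A) xA.
rewrite -cA; apply: IH => //.
have : (y |: A :\ x) :\: B \proper A :\: B.
  apply/properP; split; last by exists x; rewrite !inE ?eqxx ?xB ?xA ?andbF //=;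
    case: eqP xB => // ->; rewrite yB.
  apply/subsetP => z; rewrite !inE => /andP[zB].
  by rewrite zB /=; case: eqP zB => [->|_ _ /andP[]//]; rewrite yB.
by move=> /proper_card; lia.
Qed.

Lemma bases_dual_exchange M A B : A \in bases M -> B \in bases M ->
  forall x, x \in B :\: A ->
  exists2 y, y \in A :\: B & x |: (A :\ y) \in bases M.
Proof.
move=> hA hB x xBA; move: {2}#|_| (leqnn #|B :\: A|) => k.
elim: k B hB xBA => [|k IH] B hB xBA.
  by rewrite leqn0 cards_eq0 => /eqP e; rewrite e inE in xBA.
move=> hk; have [e|[z]] := set_0Vmem ((B :\: A) :\ x).
  have c1 : #|B :\: A| = 1 by rewrite (cardsD1 x) xBA e cards0.
  have cAB := bases_card hA hB.
  have /eqP/cards1P[y ey] : #|A :\: B| = 1.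
    have := cardsID B A; have := cardsID A B.
    rewrite (setIC B A) c1; lia.
  exists y; first by rewrite ey set11.
  suff -> : x |: A :\ y = B by [].
  apply/setP => u.
  have := congr1 (fun K : {set T} => u \in K) ey.
  have := congr1 (fun K : {set T} => u \in K) e.
  move: xBA; rewrite !inE => /andP[xA xB].
  case: (eqVneq u x) => [->|ux] /=; first by rewrite xB.
  by case: (u == y) => /=; case: (u \in A); case: (u \in B).
rewrite !inE => /and3P[zx zA zB].
have [|w wAB hB'] := bases_exchange hB hA (x := z); first by rewrite !inE zA.
move: wAB xBA; rewrite !inE => /andP[wB wA] /andP[xA xB].
have [||y] := IH _ hB'.
- by rewrite !inE xA xB (eq_sym x z) zx orbT.
- have : (w |: B :\ z) :\: A \proper B :\: A.
    apply/properP; split; last first.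
      exists z; rewrite !inE ?zA ?zB // eqxx /= orbF.
      by case: eqP zA => // ->; rewrite wA.
    apply/subsetP => u; rewrite !inE => /andP[uA].
    by rewrite uA /=; case: eqP uA => [->|_ _ /andP[]//]; rewrite wA.
  by move=> /proper_card; lia.
rewrite !inE negb_or negb_and negbK => /andP[/andP[yw /orP[/eqP->|yB]] yA] h.
  by rewrite yA in zA.
by exists y => //; rewrite !inE yB.
Qed.

Section Dual.
Variable M : matroid.

Definition dual_bases : {set {set T}} := [set ground M :\: B | B in bases M].

Lemma dual_bases_ground B : B \in dual_bases -> B \subset ground M.
Proof. by case/imsetP => C _ ->; apply: subsetDl. Qed.

Lemma dual_bases_neq0 : dual_bases != set0.
Proof.
have /set0Pn[B hB] := bases_neq0 M.
by apply/set0Pn; exists (ground M :\: B); apply: imset_f.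
Qed.

Lemma dual_bases_exchange A B : A \in dual_bases -> B \in dual_bases ->
  forall x, x \in A :\: B ->
  exists2 y, y \in B :\: A & y |: (A :\ x) \in dual_bases.
Proof.
case/imsetP => A0 hA0 -> /imsetP[B0 hB0 ->] x.
have sA := subsetP (bases_ground hA0); have sB := subsetP (bases_ground hB0).
rewrite !inE => /andP[]; rewrite negb_and negbK => hx /andP[xA0 xE].
move: hx; rewrite xE orbF => xB0.
have [|y] := bases_dual_exchange hA0 hB0 (x := x); first by rewrite !inE xA0.
rewrite !inE => /andP[yB yA] h.
exists y; first by rewrite !inE yB yA (sA _ yA).
apply/imsetP; exists (x |: A0 :\ y) => //.
apply/setP => u; rewrite !inE.
case: (eqVneq u y) => [->|uy] /=.
  by rewrite (sA _ yA) orbF andbT; case: eqP yA xA0 => // -> ->.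
by rewrite negb_or andbA.
Qed.

Definition dual : matroid :=
  Matroid dual_bases_ground dual_bases_neq0 dual_bases_exchange.
End Dual.

Definition indep M (I : {set T}) := [exists B in bases M, I \subset B].

Definition circuit M (C : {set T}) :=
  minset [pred X : {set T} | (X \subset ground M) && ~~ indep M X] C.

Definition loop M e := (e \in ground M) && [forall B in bases M, e \notin B].
Definition coloop M e := (e \in ground M) && [forall B in bases M, e \in B].
Definition loopless M := forall e, ~~ loop M e.
Definition coloopless M := forall e, ~~ coloop M e.

Definition same_component M e f :=
  (e == f) || [exists C, [&& circuit M C, e \in C & f \in C]].

Definition components M : {set {set T}} :=
  [set [set f in ground M | same_component M e f] | e in ground M].

Definition is_deletion M f N :=
  ground N = ground M :\ f /\
  forall I : {set T}, indep N I = indep M I && (f \notin I).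

Definition parallel_extension N M :=
  exists e f, [/\ e != f, f \in ground M, circuit M [set e; f]
                & is_deletion M f N].

Definition series_extension N M := parallel_extension (dual N) (dual M).

Inductive series_parallel : matroid -> Prop :=
| SP_loop M e : ground M = [set e] -> bases M = [set set0] ->
    series_parallel M
| SP_coloop M e : ground M = [set e] -> bases M = [set [set e]] ->
    series_parallel M
| SP_parallel N M : series_parallel N -> parallel_extension N M ->
    series_parallel M
| SP_series N M : series_parallel N -> series_extension N M ->
    series_parallel M.

(* [F X] is only relevant for the blocks [X] of [P]; it is the summand with
   ground set [X]. *)
Definition is_direct_sum (P : {set {set T}}) (F : {set T} -> matroid) N :=
  [/\ partition P (ground N),
      forall X, X \in P -> ground (F X) = X
    & forall B : {set T}, (B \in bases N) =
        (B \subset ground N) && [forall X in P, B :&: X \in bases (F X)]].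

Definition direct_sum_of_series_parallel N :=
  exists P F, is_direct_sum P F N /\
    forall X, X \in P -> series_parallel (F X).

End Matroids.

Section Schubert.
Variable n : nat.
Implicit Types U B I J : {set 'I_n}.

(* [enum I] lists the elements of [I] in increasing order, and [all2] also
   requires both lists to have the same size. *)
Definition gale_le I J :=
  all2 (fun i j : 'I_n => i <= j) (enum I) (enum J).

Lemma sorted_all2_leqP (s t : seq nat) : sorted ltn s -> sorted ltn t ->
  reflect (size s = size t /\
           forall k, count (fun i => i < k) t <= count (fun i => i < k) s)
          (all2 leq s t).
Proof.
move=> ss st; apply: (iffP idP).
  elim: s t {ss st} => [|a s IH] [|b t] //= /andP[ab /IH[-> h]].
  by split=> // k; have := h k; lia.
elim: s t ss st => [|a s IH] [|b t] //=; try by move=> _ _ [].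
move=> pa pb [[es] h].
have ha : forall i, i \in s -> a < i.
  by apply/allP; apply: order_path_min pa; apply: ltn_trans.
have hb : forall i, i \in t -> b < i.
  by apply/allP; apply: order_path_min pb; apply: ltn_trans.
have ab : a <= b.
  rewrite leqNgt; apply/negP => ba.
  have c0 : count (fun i => i < b.+1) s = 0; last by have := h b.+1; lia.
  by apply/eqP; rewrite -leqn0 leqNgt -has_count; apply/hasPn => i /ha; lia.
rewrite ab /=; apply: IH; rewrite ?(path_sorted pa) ?(path_sorted pb) //.
split=> // k; have := h k; case: (ltnP b k) => bk; first lia.
suff -> : count (fun i => i < k) t = 0 by [].
by apply/eqP; rewrite -leqn0 leqNgt -has_count; apply/hasPn => i /hb; lia.
Qed.

Lemma gale_leP I J :
  reflect (#|I| = #|J| /\ forall k : nat,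
             #|[set i in J | i < k]| <= #|[set i in I | i < k]|)
          (gale_le I J).
Proof.
have sE (K : {set 'I_n}) : sorted ltn (map val (enum K)).
  have sub : subseq (enum K) (enum 'I_n) by rewrite enumT; apply: filter_subseq.
  apply: (subseq_sorted ltn_trans (map_subseq val sub)).
  by rewrite val_enum_ord iota_ltn_sorted.
have cE (K : {set 'I_n}) k : #|[set i in K | i < k]| =
    count (fun i => i < k) (map val (enum K)).
  rewrite -sum1_count big_map big_enum_cond /= -sum1_card.
  by apply: eq_bigl => i; rewrite inE.
have -> : gale_le I J = all2 leq (map val (enum I)) (map val (enum J)).
  by rewrite /gale_le; elim: (enum I) (enum J) => [|a s IH] [|b t] //=;
    rewrite IH.
apply: (iffP (sorted_all2_leqP (sE I) (sE J))); rewrite !size_map -!cardE.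
  by case=> eIJ h; split=> // k; rewrite !cE.
by case=> eIJ h; split=> // k; rewrite -!cE.
Qed.

Definition schubert_bases U : {set {set 'I_n}} :=
  [set B : {set 'I_n} | (#|B| == #|U|) && gale_le U B].

Lemma schubert_bases_ground U B :
  B \in schubert_bases U -> B \subset [set: 'I_n].
Proof. by rewrite subsetT. Qed.

Lemma schubert_bases_neq0 U : schubert_bases U != set0.
Proof.
apply/set0Pn; exists U; rewrite inE eqxx /=.
by apply/gale_leP.
Qed.

Lemma schubert_bases_exchange U A B :
  A \in schubert_bases U -> B \in schubert_bases U ->
  forall x, x \in A :\: B ->
  exists2 y, y \in B :\: A & y |: (A :\ x) \in schubert_bases U.
Proof.
rewrite !inE => /andP[/eqP cA /gale_leP[_ hA]] /andP[/eqP cB /gale_leP[_ hB]].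
move=> x xAB.
have [y0 y0BA] : exists y, y \in B :\: A.
  apply/set0Pn; rewrite -card_gt0.
  have := cardsID A B; have := cardsID B A.
  have : 0 < #|A :\: B| by apply/card_gt0P; exists x.
  by rewrite (setIC B A); lia.
have [y yBA ymax] := arg_maxnP (fun i : 'I_n => i : nat) y0BA.
exists y => //.
move: xAB; rewrite inE => /andP[xB xA].
move: (yBA : y \in B :\: A); rewrite inE => /andP[yA yB].
have cS : #|y |: A :\ x| = #|A|.
  by rewrite cardsU1 !inE (negPf yA) andbF /= (cardsD1 x A) xA.
rewrite inE cS cA eqxx /=; apply/gale_leP; split=> [|k]; first by rewrite cS.
have eK : #|[set i in y |: A :\ x | i < k]| + (x < k) =
          #|[set i in A | i < k]| + (y < k).
  have -> : #|[set i in y |: A :\ x | i < k]| =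
     (y < k) + #|[set i in A | i < k] :\ x|.
    rewrite (cardsD1 y) !inE eqxx /=; congr (_ + #|pred_of_set _|).
    apply/setP => u; rewrite !inE.
    by case: (eqVneq u y) => [->|_] //=; rewrite ?(negPf yA) ?andbF // andbA.
  rewrite [in RHS](cardsD1 x) !inE xA /=.
  by rewrite addnC addnA addnAC.
case: (ltnP y k) eK => yk; last first.
  by rewrite addn0 => eK; apply: leq_trans (hA k); rewrite -eK leq_addr.
case: (ltnP x k) => xk; first by move/addIn => ->; apply: hA.
rewrite addn0 addn1 => ->; apply: leq_trans (hB k).
have spl (K : {set 'I_n}) :
    #|K| = #|[set i in K | i < k]| + #|[set i in K | k <= i]|.
  rewrite -(cardsID [set i : 'I_n | i < k] K); congr (_ + _); apply: eq_card => i.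
    by rewrite !inE.
  by rewrite !inE -leqNgt andbC.
have : #|[set i in B | k <= i]| < #|[set i in A | k <= i]|.
  apply: proper_card; apply/properP; split; last first.
    by exists x; rewrite !inE ?xA ?(negPf xB) //.
  apply/subsetP => u; rewrite !inE => /andP[uB ku]; rewrite ku andbT.
  apply/negPn/negP => uA; have uBA : u \in B :\: A by rewrite inE uA uB.
  by have := leq_trans ku (ymax u uBA); rewrite leqNgt yk.
by have := spl A; have := spl B; rewrite cA cB; lia.
Qed.

Definition schubert U : matroid 'I_n :=
  Matroid (@schubert_bases_ground U) (schubert_bases_neq0 U)
          (@schubert_bases_exchange U).

(* The element k of {1, ..., n} is the ordinal k - 1. [path_point P k] is the
   endpoint of the first k steps of path(P). *)
Definition path_point (P : {set 'I_n}) (k : nat) : nat * nat :=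
  (#|[set i : 'I_n | (i < k) && (i \notin P)]|,
   #|[set i : 'I_n | (i < k) && (i \in P)]|).

Definition vertical_step (P : {set 'I_n}) (p : nat * nat) :=
  [exists i in P, path_point P i == p].

Definition lower_set U : {set 'I_n} := [set i : 'I_n | n - #|U| <= i].

Definition in_region U (p : nat * nat) :=
  [exists k : 'I_n.+1, ((path_point U k).1 == p.1)
                    && (p.2 <= (path_point U k).2)] &&
  [exists k : 'I_n.+1, ((path_point (lower_set U) k).1 == p.1)
                    && ((path_point (lower_set U) k).2 <= p.2)].

End Schubert.

Inductive step := East | North | Diagonal.

Definition step_end (p : nat * nat) (s : step) : nat * nat :=
  match s with
  | East => (p.1.+1, p.2)
  | North => (p.1, p.2.+1)
  | Diagonal => (p.1.+1, p.2.+1)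
  end.

Definition is_diagonal (s : step) := if s is Diagonal then true else false.

Definition diagonals (s : seq step) := count is_diagonal s.

Section Delannoy.
Variables (n : nat) (U : {set 'I_n}).

Definition north_allowed p :=
  in_region U (step_end p North) && ~~ vertical_step U p.

Definition step_allowed p s :=
  in_region U (step_end p s) &&
  match s with
  | East => true
  | North | Diagonal => north_allowed p
  end.

Fixpoint admissible_from p (s : seq step) :=
  if s is a :: s' then step_allowed p a && admissible_from (step_end p a) s'
  else p == (n - #|U|, #|U|).

Definition admissible_delannoy (s : seq step) : Prop :=
  in_region U (1, 1) && admissible_from (1, 1) s.

End Delannoy.

From mathcomp Require Import boolp classical_sets functions cardinality reals.
Import GRing.Theory Num.Theory.
Local Open Scope classical_set_scope.
Local Open Scope ring_scope.

Section Polytopes.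
Variables (R : realType) (n : nat).
Implicit Types (C F P : set 'rV[R]_n) (S : set (set 'rV[R]_n)).

Definition convex_hull (s : seq 'rV[R]_n) : set 'rV[R]_n :=
  [set x | exists l : 'I_(size s) -> R,
     [/\ forall i, 0 <= l i, \sum_i l i = 1 & x = \sum_i l i *: s`_i]].

Definition polytope C := exists s, C = convex_hull s.

Definition dot (c x : 'rV[R]_n) : R := \sum_i c ord0 i * x ord0 i.

Definition face C F :=
  F = set0 \/
  exists c, F = [set x | C x /\ forall y, C y -> dot c y <= dot c x].

(* Boundary relative to the affine hull. *)
Definition boundary P : set 'rV[R]_n :=
  [set x | exists F, [/\ face P F, F <> P & F x]].

(* The empty face is not counted as a cell. *)
Definition polyhedral_subdivision P S :=
  [/\ finite_set S,
      forall Q, S Q -> polytope Q /\ Q !=set0,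
      \bigcup_(Q in S) Q = P,
      forall Q F, S Q -> face Q F -> F !=set0 -> S F
    & forall Q Q', S Q -> S Q' ->
        face Q (Q `&` Q') /\ face Q' (Q `&` Q')].

Definition maximal_cells S : set (set 'rV[R]_n) :=
  [set Q | S Q /\ forall Q', S Q' -> Q `<=` Q' -> Q' = Q].

Definition internal_faces P S : set (set 'rV[R]_n) :=
  [set Q | S Q /\ ~ (Q `<=` boundary P)].

Definition indicator (B : {set 'I_n}) : 'rV[R]_n :=
  \row_i (i \in B)%:R.

(* Meant for matroids whose ground set is all of 'I_n. *)
Definition base_polytope (N : matroid 'I_n) : set 'rV[R]_n :=
  convex_hull [seq indicator B | B <- enum (bases N)].

Definition matroid_subdivision P S :=
  polyhedral_subdivision P S /\
  forall Q, S Q -> exists N, ground N = [set: 'I_n]%SET /\ Q = base_polytope N.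

End Polytopes.

Arguments base_polytope R {n} N.

(* Main.v *)
(** Write s_k(x) = x_1 + ... + x_k.  The base polytope of the Schubert matroid
    consists of the x in [0,1]^n with s_n(x) = r and s_k(x) <= |U cap [k]| for
    all k; we cut it along all hyperplanes on which some s_k is an integer.
    The smallest cell containing x is cut out by floor <= . <= ceil conditions
    on the s_k and the x_l, and every cell is the hull of its 0/1 points
    because rounding all s_k the same way stays in the cell.  The 0/1 points of
    a cell are the bases of a matroid whose elements split into blocks: the
    l with x_l integral are loops and coloops, the others are grouped between
    consecutive integral s_k.  A block is series-parallel because its first two
    elements are parallel or in series, and merging them (replacing the weights
    x_1, x_2 by x_1 + x_2 or x_1 + x_2 - 1) leaves a block of the same kind.
    For x in the relative interior of the polytope no x_l is integral, so the
    blocks are the components; recording, for 0 < k < n, the unit interval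
    or the integer in which s_k(x) lies is the same as giving a Delannoy path
    from (1,1) to (n-r,r), an integral s_k being a diagonal step. *)

Require Import Defs.
From mathcomp Require Import boolp classical_sets functions cardinality reals.
From mathcomp Require Import all_boot all_order all_algebra.
From mathcomp Require Import zify ring lra.
Set Implicit Arguments.
Unset Strict Implicit.
Unset Printing Implicit Defensive.
Import Order.TTheory GRing.Theory Num.Theory.

(** * Prefix counts of sets and an exchange that controls them *)

Section Counting.
Variable n : nat.
Implicit Types A B : {set 'I_n}.

(** A matroid is always carried by a weight vector, a point of its cell, so that duality, merging of
    elements and splitting into blocks become operations on numbers. The dictionary with paths rests
    on this: at an interior point all increments of s lie strictly between 0 and 1. If s_{a+b-1} is
    in (b-1, b), then s_{a+b} is in (b-1, b+1), and comparing it with b leaves three cases: below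
    (east), above (north), equal (diagonal). In the last case the next value lies in (b, b+1),
    because two consecutive s_k are never both integral; this is why a diagonal step may skip an
    antidiagonal. The strict bound s_k < |U cap [k]| yields rules (ii) and (iii): reaching or
    passing b at k = a + b requires b < |U cap [a+b]|. Looplessness makes path(U) start with a north
    step and the absence of coloops makes it end with an east step, which leaves room for the end
    points (1,1) and (n-r,r). Relative interiors are handled without dimension or topology: a point
    is interior when every segment ending at it can be prolonged a little. *)

Definition cnt B (k : nat) := #|[set i in B | i < k]|.

Lemma cnt0 B : cnt B 0 = 0.
Proof. by apply: eq_card0 => i; rewrite inE andbF. Qed.

Lemma cntS B (l : 'I_n) : cnt B l.+1 = cnt B l + (l \in B).
Proof.
rewrite /cnt (cardsD1 l) !inE ltnSn andbT addnC; congr (_ + _).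
apply: eq_card => i; rewrite !inE ltnS leq_eqVlt.
have -> : (i == l :> nat) = (i == l) by [].
by case: (eqVneq i l) => [->|] //=; rewrite ltnn andbF.
Qed.

Lemma cnt_ge B k : n <= k -> cnt B k = #|B|.
Proof.
move=> nk; apply: eq_card => i; rewrite inE.
by rewrite (leq_trans (ltn_ord i) nk) andbT.
Qed.

Lemma cntS_bounds B k : cnt B k <= cnt B k.+1 <= (cnt B k).+1.
Proof.
case: (ltnP k n) => kn; last by rewrite !cnt_ge ?leqnn //; lia.
by rewrite (cntS B (Ordinal kn)) /=; case: (_ \in _); lia.
Qed.

Lemma cnt_swap A x y k : x \in A -> y \notin A ->
  cnt (y |: A :\ x) k + (x < k) = cnt A k + (y < k).
Proof.
move=> xA yA; rewrite /cnt.
have -> : #|[set i in y |: A :\ x | i < k]| =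
    (y < k) + #|[set i in A | i < k] :\ x|.
  rewrite (cardsD1 y) !inE eqxx /=; congr (_ + #|pred_of_set _|).
  apply/setP => u; rewrite !inE.
  by case: (eqVneq u y) => [->|_] //=; rewrite ?(negPf yA) ?andbF // andbA.
by rewrite [in RHS](cardsD1 x) !inE xA /= addnC addnA addnAC.
Qed.

(* Swap [x] with the nearest element of [B] beyond which the count of [A] no
   longer strictly exceeds (or falls short of) that of [B]. *)
Lemma exchange_between A B x : #|A| = #|B| -> x \in A :\: B ->
  exists2 y, y \in B :\: A & forall k,
    minn (cnt A k) (cnt B k) <= cnt (y |: A :\ x) k
      <= maxn (cnt A k) (cnt B k).
Proof.
move=> cAB; rewrite inE => /andP[xB xA].
have cAx := cntS A x; have cBx := cntS B x.
rewrite xA in cAx; rewrite (negPf xB) in cBx.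
case: (leqP (cnt B x) (cnt A x)) => hx.
  have ex : exists k, (x < k) && (cnt A k <= cnt B k).
    by exists n; rewrite ltn_ord !cnt_ge // cAB leqnn.
  case: (ex_minnP ex) => k /andP[xk hk] kmin.
  have k_gt : x.+1 < k.
    rewrite ltn_neqAle xk andbT; apply/eqP => e; rewrite -e in hk; lia.
  have yn : k.-1 < n.
    have /kmin : (x < n) && (cnt A n <= cnt B n).
      by rewrite ltn_ord !cnt_ge // cAB leqnn.
    lia.
  pose y := Ordinal yn.
  have ek : k = y.+1 by rewrite /=; lia.
  have above j : x < j -> j <= y -> cnt B j < cnt A j.
    move=> xj jy; rewrite ltnNge; apply/negP => hj.
    have /kmin : (x < j) && (cnt A j <= cnt B j) by rewrite xj.
    lia.
  have xy : x < y by lia.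
  have hy := above y xy (leqnn _); move: hk; rewrite ek !cntS => hk.
  have yA : y \notin A by apply/negP => yA; rewrite yA in hk; lia.
  have yB : y \in B by apply/negPn/negP => yB; rewrite (negPf yB) in hk; lia.
  exists y; first by rewrite inE yA.
  move=> j; have := cnt_swap j xA yA.
  by case: (ltnP x j) => xj; case: (ltnP y j) => yj; try (have := above _ xj yj);
    lia.
have ex : exists k, (k <= x) && (cnt B k <= cnt A k).
  by exists 0; rewrite !cnt0.
have bd k : (k <= x) && (cnt B k <= cnt A k) -> k <= x by case/andP.
case: (ex_maxnP ex bd) => k /andP[kx hk] kmax.
have k_lt : k < x.
  by rewrite ltn_neqAle kx andbT; apply/eqP => e; rewrite -e in hx; lia.
pose y := Ordinal (ltn_trans k_lt (ltn_ord x)).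
have ek : k = y by [].
have below j : y < j -> j <= x -> cnt A j < cnt B j.
  move=> yj jx; rewrite ltnNge; apply/negP => hj.
  have /kmax : (j <= x) && (cnt B j <= cnt A j) by rewrite jx.
  by rewrite /= in yj *; lia.
have hy := below y.+1 (ltnSn _) k_lt; move: hy hk; rewrite ek !cntS => hy hk.
have yA : y \notin A by apply/negP => yA; rewrite yA in hy; lia.
have yB : y \in B by apply/negPn/negP => yB; rewrite (negPf yB) in hy; lia.
exists y; first by rewrite inE yA.
move=> j; have := cnt_swap j xA yA.
by case: (ltnP y j) => yj; case: (ltnP x j) => xj;
  try (have := below _ yj xj); lia.
Qed.

End Counting.

(** * Matroids defined by rounding a weight vector *)

Section WeightedMatroids.
Local Open Scope ring_scope.
Variables (R : realType) (n : nat).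
Implicit Types (X A B : {set 'I_n}) (x y : 'I_n -> R) (M N : matroid 'I_n).

Lemma int_near_eq (a b : R) : a \is a Num.int -> b \is a Num.int ->
  `|a - b| < 1 -> a = b.
Proof.
move=> ia ib h; apply/eqP; rewrite -subr_eq0; apply/negPn/negP => ne.
have := norm_intr_ge1 (rpredB ia ib) ne; lra.
Qed.

Lemma int_step (a b : R) : a \is a Num.int -> b \is a Num.int ->
  a <= b -> b < a + 2 -> b = a \/ b = a + 1.
Proof.
move=> ia ib ab b2; have [lt1|ge1] := ltrP b (a + 1).
  by left; apply: int_near_eq => //; rewrite ltr_norml; lra.
by right; apply: int_near_eq; rewrite ?rpredD ?rpred1 // ltr_norml; lra.
Qed.

Lemma int_lt_le (a b : R) : a \is a Num.int -> b \is a Num.int ->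
  a < b + 1 -> a <= b.
Proof.
move=> ia ib ab; rewrite leNgt; apply/negP => ba.
have : a = b by apply: int_near_eq; rewrite // ltr_norml; lra.
by lra.
Qed.

Definition psum X x (k : nat) : R := \sum_(l in X | (l < k)%N) x l.
Definition charf B (l : 'I_n) : R := (l \in B)%:R.

Lemma psum0 X x : psum X x 0 = 0.
Proof. by rewrite /psum big1 // => l; rewrite andbF. Qed.

Lemma psumS X x (l : 'I_n) :
  psum X x l.+1 = psum X x l + (if l \in X then x l else 0).
Proof.
rewrite /psum; case: ifPn => lX.
  rewrite (bigD1 l) ?lX ?leqnn //= addrC; congr (_ + _).
  apply: eq_bigl => i; rewrite ltnS [(i <= l)%N]leq_eqVlt.
  have -> : (i == l :> nat) = (i == l) by [].
  by case: (eqVneq i l) => [->|] /=; rewrite ?ltnn ?andbF ?andbT.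
rewrite addr0; apply: eq_bigl => i; rewrite ltnS [(i <= l)%N]leq_eqVlt.
have -> : (i == l :> nat) = (i == l) by [].
by case: (eqVneq i l) => [->|] //=; rewrite (negPf lX).
Qed.

Lemma psum_ge X x k : (n <= k)%N -> psum X x k = psum X x n.
Proof.
move=> nk; apply: eq_bigl => i; rewrite ltn_ord.
by rewrite (leq_trans (ltn_ord i) nk).
Qed.

Lemma psum_int X x k : (forall l, l \in X -> x l \is a Num.int) ->
  psum X x k \is a Num.int.
Proof. by move=> h; apply: rpred_sum => l /andP[/h]. Qed.

Lemma charf_int B l : charf B l \is a Num.int.
Proof. exact: natr_int. Qed.

Lemma psum_charf_int X B k : psum X (charf B) k \is a Num.int.
Proof. by apply: psum_int => l _; apply: charf_int. Qed.

Lemma psum_charf X B k : B \subset X -> psum X (charf B) k = (cnt B k)%:R.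
Proof.
move=> sBX; rewrite /psum /cnt -sum1_card natr_sum big_mkcond [RHS]big_mkcond /=.
apply: eq_bigr => l _; rewrite inE /charf.
have := subsetP sBX l; case: (l \in B) => [->|_] //=.
by case: ifP.
Qed.

Lemma psumD1 X x f k : f \in X ->
  psum X x k = (if (f < k)%N then x f else 0) + psum (X :\ f) x k.
Proof.
move=> fX; rewrite /psum [LHS]big_mkcond (bigD1 f) //= fX /=; congr (_ + _).
rewrite -big_mkcondr; apply: eq_bigl => i; rewrite !inE.
by case: (i == f); rewrite ?andbF.
Qed.

Lemma eq_psum X x y k : (forall l, l \in X -> (l < k)%N -> x l = y l) ->
  psum X x k = psum X y k.
Proof. by move=> h; apply: eq_bigr => l /andP[]; apply: h. Qed.

Lemma psum_eq0 X x k : (forall l, l \in X -> (k <= l)%N) -> psum X x k = 0.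
Proof. by move=> h; apply: big1 => l /andP[/h]; lia. Qed.

Lemma le_psum X x j k : (forall l, l \in X -> 0 <= x l) -> (j <= k)%N ->
  psum X x j <= psum X x k.
Proof.
move=> x0 jk; rewrite /psum [leLHS]big_mkcond [leRHS]big_mkcond /=.
apply: ler_sum => l _; case: (boolP (l \in X)) => //= lX.
case: (ltnP l j) => lj; first by rewrite (leq_trans lj jk).
by case: ifP => // _; apply: x0.
Qed.

Definition weighting X x :=
  (forall l, l \in X -> 0 <= x l <= 1) /\ psum X x n \is a Num.int.

(* For an integer [m], [`|m - t| < 1] says [floor t <= m <= ceil t]. *)
Definition wbase X x B :=
  [&& B \subset X,
      [forall k : 'I_n.+1, `|psum X (charf B) k - psum X x k| < 1]
    & [forall l in X, `|charf B l - x l| < 1]].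

Lemma wbaseP X x B :
  reflect [/\ B \subset X,
              forall k, `|psum X (charf B) k - psum X x k| < 1
            & forall l, l \in X -> `|charf B l - x l| < 1]
          (wbase X x B).
Proof.
apply: (iffP and3P) => [[sB /forallP h1 /forall_inP h2]|[sB h1 h2]].
  split=> // k; case: (ltnP k n.+1) => kn; first exact: (h1 (Ordinal kn)).
  by rewrite !(psum_ge _ _ (ltnW kn)); apply: (h1 ord_max).
by split=> //; [apply/forallP => k; apply: h1 | apply/forall_inP].
Qed.

Definition has_weights M X x :=
  ground M = X /\ forall B, (B \in bases M) = wbase X x B.

Lemma set_of_counts X (g : nat -> R) :
  g 0%N = 0 ->
  (forall l : 'I_n, l \in X -> g l.+1 = g l \/ g l.+1 = g l + 1) ->
  (forall l : 'I_n, l \notin X -> g l.+1 = g l) ->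
  exists B, [/\ B \subset X, forall k, (k <= n)%N -> psum X (charf B) k = g k
    & forall l : 'I_n, l \in X -> charf B l = g l.+1 - g l].
Proof.
move=> g0 gX gnX; pose B := [set l : 'I_n | g l.+1 != g l].
have sB : B \subset X.
  by apply/subsetP => l; rewrite inE; apply: contraR => /gnX ->.
have cB (l : 'I_n) : l \in X -> charf B l = g l.+1 - g l.
  move=> lX; rewrite /charf inE; case: (gX l lX) => ->.
    by rewrite eqxx subrr.
  rewrite addrAC subrr add0r; case: eqP => //= /eqP; lra.
exists B; split=> //; elim=> [|k IH] kn; first by rewrite psum0 g0.
rewrite (psumS _ _ (Ordinal kn)) /= IH; last lia.
case: ifPn => lX; first by rewrite cB //=; lra.
by rewrite -(gnX _ lX) addr0.
Qed.

(** As weights lie in [0,1], consecutive floors differ by 0 or 1 and so are the counts of a set; a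
    weight 0 or 1 shifts the floor by exactly itself. The shift [theta] is left free so that a basis
    can be made to contain a chosen element. *)
Lemma rounding_base X x (theta : R) : weighting X x -> 0 <= theta < 1 ->
  exists2 B, wbase X x B & forall k, (k <= n)%N ->
    psum X (charf B) k = (Num.floor (psum X x k + theta))%:~R.
Proof.
move=> [x01 xint] th.
pose g k : R := (Num.floor (psum X x k + theta))%:~R.
have gb k : psum X x k + theta - 1 < g k <= psum X x k + theta.
  rewrite /g; have := Num.Theory.floor_itv (psum X x k + theta).
  by rewrite intrD; lra.
have gi k : g k \is a Num.int by apply: intr_int.
have stp (l : 'I_n) : l \in X -> g l.+1 = g l \/ g l.+1 = g l + 1.
  move=> lX; have := x01 l lX; have := psumS X x l; rewrite lX => e b.
  have := gb l; have := gb l.+1; rewrite e => b1 b2; apply: int_step => //; last lra.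
  by rewrite /g ler_int; apply: Num.Theory.le_floor; rewrite e; lra.
have [|//|l lX|B [sB cB eB]] := @set_of_counts X g.
- rewrite /g psum0 add0r; suff -> : Num.floor theta = 0 by [].
  by apply/Num.Theory.floor_def; lra.
- by rewrite /g psumS (negPf lX) addr0.
exists B => //; apply/wbaseP; split=> // [k|l lX].
  wlog kn : k / (k <= n)%N.
    move=> H; case: (leqP k n) => [/H //|/ltnW nk].
    by rewrite !(psum_ge _ _ nk); apply: H.
  by rewrite cB //; have := gb k; rewrite ltr_norml; lra.
rewrite eB //; have := psumS X x l; rewrite lX => e.
have := gb l; have := gb l.+1; rewrite e ltr_norml => b1 b2.
have b3 := x01 l lX.
have g1 : x l = 1 -> g l.+1 = g l + 1.
  by move=> e1; rewrite /g e e1 addrAC Num.Theory.floorDrz ?rpred1 // intrD floor1.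
have g0 : x l = 0 -> g l.+1 = g l by move=> e0; rewrite /g e e0 addr0.
have [/g1 ?|/eqP x1] := eqVneq (x l) 1; first lra.
have [/g0 ?|/eqP x0] := eqVneq (x l) 0; first lra.
have {}x1 : x l < 1 by rewrite lt_neqAle; apply/andP; split; [exact/eqP|lra].
have {}x0 : 0 < x l.
  by rewrite lt_neqAle; apply/andP; split; [rewrite eq_sym; exact/eqP|lra].
by case: (stp l lX) => ->; lra.
Qed.

(** The admissible counts at each position form an interval, so counts between those of [A] and [B]
    remain admissible; at each single element the new set agrees with [A] or with [B]. Integrality
    of the total weight makes the two cardinalities equal. *)
Lemma wbase_exchange X x A B : psum X x n \is a Num.int ->
  wbase X x A -> wbase X x B -> forall l, l \in A :\: B ->
  exists2 l', l' \in B :\: A & wbase X x (l' |: (A :\ l)).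
Proof.
move=> xint /wbaseP[sA cA eA] /wbaseP[sB cB eB] l lAB.
have total (D : {set 'I_n}) : D \subset X ->
    (forall k, `|psum X (charf D) k - psum X x k| < 1) ->
    (#|D|%:R : R) = psum X x n.
  move=> sD hD; rewrite -(cnt_ge D (leqnn n)) -(psum_charf _ sD).
  by apply: int_near_eq (hD n) => //; apply: psum_charf_int.
have cAB : #|A| = #|B|.
  by apply/eqP; rewrite -(eqr_nat R) (total A) // (total B).
have [l' l'BA btw] := exchange_between cAB lAB; exists l' => //.
move: lAB l'BA; rewrite !inE => /andP[lB lA] /andP[l'A l'B].
have sC : l' |: A :\ l \subset X.
  apply/subsetP => i; rewrite !inE => /orP[/eqP->|/andP[_]].
    exact: (subsetP sB).
  exact: (subsetP sA).
apply/wbaseP; split=> // [k|i iX].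
  have := cA k; have := cB k; rewrite !psum_charf // !ltr_norml.
  have /andP[] := btw k; rewrite -(ler_nat R) -[(_ <= maxn _ _)%N](ler_nat R).
  by rewrite /minn /maxn; case: ifP => _ *; lra.
have := eA i iX; have := eB i iX; rewrite /charf !inE.
case: (eqVneq i l') => [->|_] /=; first by rewrite l'B.
by case: (eqVneq i l) => [->|_] //=; rewrite (negPf lB).
Qed.

Lemma weights_matroid X x : weighting X x -> exists M, has_weights M X x.
Proof.
move=> wx; have [_ xint] := wx.
pose b : {set {set 'I_n}} := [set B | wbase X x B]%SET.
have bg B : B \in b -> B \subset X by rewrite inE => /wbaseP[].
have bn : b != set0%SET.
  apply/set0Pn; have [|B hB _] := @rounding_base X x 0 wx; first lra.
  by exists B; rewrite inE.
have bx A B : A \in b -> B \in b -> forall l, l \in A :\: B ->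
    exists2 y, y \in B :\: A & y |: (A :\ l) \in b.
  rewrite !inE => hA hB l lAB.
  have [y hy hC] := wbase_exchange xint hA hB lAB.
  by exists y => //; rewrite inE.
by exists (Matroid bg bn bx); split=> //= B; rewrite inE.
Qed.

Lemma psum_opp X x k : psum X (fun l => 1 - x l) k = psum X (fun=> 1) k - psum X x k.
Proof. by rewrite /psum sumrB. Qed.

(** Complementation changes the sign of every deviation and nothing else. Through duality, this
    reduces the series case to the parallel one. *)
Lemma wbase_compl X x B : B \subset X ->
  wbase X (fun l => 1 - x l) (X :\: B) = wbase X x B.
Proof.
move=> sB; have eB l : l \in X -> charf (X :\: B) l = 1 - charf B l.
  by move=> lX; rewrite /charf inE lX andbT; case: (l \in B); rewrite /= ?subrr ?subr0.
have pB k : psum X (charf (X :\: B)) k = psum X (fun=> 1) k - psum X (charf B) k.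
  by rewrite -psum_opp; apply: eq_psum => l lX _; apply: eB.
have dist (a b d : R) : `|d - a - (d - b)| = `|a - b|.
  by rewrite distrC; congr (`| _ |); ring.
apply/wbaseP/wbaseP => -[_ h1 h2]; split=> //; rewrite ?subsetDl //.
- by move=> k; have := h1 k; rewrite pB psum_opp dist.
- by move=> l lX; have := h2 l lX; rewrite eB // dist.
- by move=> k; rewrite pB psum_opp dist.
- by move=> l lX; rewrite eB // dist; apply: h2.
Qed.

Lemma dual_weights M X x : has_weights M X x ->
  has_weights (dual M) X (fun l => 1 - x l).
Proof.
case=> gM bM; split=> // B; apply/imsetP/idP => [[C hC ->]|hB].
  by rewrite gM wbase_compl -?bM // -gM bases_ground.
have sB : B \subset X by case/wbaseP: hB.
have eB : B = X :\: (X :\: B) by rewrite setDDr setDv set0U; apply/esym/setIidPr.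
by exists (X :\: B); rewrite ?gM // bM -wbase_compl ?subsetDl // -eB.
Qed.

(** * Merging the first two elements of a block *)

Section Merge.
Variables (X : {set 'I_n}) (x x' : 'I_n -> R) (f e : 'I_n).
Hypotheses (fX : f \in X) (eX : e \in X) (fe : (f < e)%N).
Hypothesis first : forall l, l \in X -> l != f -> (e <= l)%N.
Hypothesis x'e : forall l, l \in X -> l != f -> l != e -> x' l = x l.

Let fne : e != f. Proof. by apply: contraTneq fe => ->; rewrite ltnn. Qed.
Let eX' : e \in X :\ f. Proof. by rewrite !inE fne. Qed.

Lemma psum_before k : (k <= e)%N -> psum X x k = if (f < k)%N then x f else 0.
Proof.
move=> ke; rewrite (psumD1 _ _ fX) psum_eq0 ?addr0 // => l; rewrite !inE.
by case/andP => lf lX; apply: leq_trans ke _; apply: first.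
Qed.

Lemma psum_before' (y : 'I_n -> R) k : (k <= e)%N -> psum (X :\ f) y k = 0.
Proof.
move=> ke; rewrite psum_eq0 // => l; rewrite !inE.
by case/andP => lf lX; apply: leq_trans ke _; apply: first.
Qed.

(** The difference is constant beyond [e], so a merge that alters the total by an integer preserves
    the integrality of all later cuts. *)
Lemma psum_after k : (e < k)%N ->
  psum X x k - psum (X :\ f) x' k = x f + x e - x' e.
Proof.
move=> ek; rewrite (psumD1 _ _ fX) (psumD1 x _ eX') (psumD1 x' _ eX') ek.
rewrite (ltn_trans fe ek).
have -> : psum (X :\ f :\ e) x' k = psum (X :\ f :\ e) x k; last by ring.
by apply: eq_psum => l; rewrite !inE => /and3P[le lf lX] _; apply: x'e.
Qed.

End Merge.

(** A basis cannot contain both elements, since a count of 2 is at distance at least 1 from a joint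
    weight of at most 1. Each of them can occur, [f] can always be traded for [e], and the bases
    avoiding [f] are those of the merged weights. *)
Lemma parallel_weights M N X x x' f e :
  has_weights M X x -> has_weights N (X :\ f) x' ->
  weighting X x -> f \in X -> e \in X -> (f < e)%N ->
  (forall l, l \in X -> l != f -> (e <= l)%N) ->
  0 < x f < 1 -> 0 < x e < 1 -> x f + x e <= 1 ->
  x' e = x f + x e ->
  (forall l, l \in X -> l != f -> l != e -> x' l = x l) ->
  parallel_extension N M.
Proof.
move=> [gM bM] [gN bN] wx fX eX fe first xf xe le1 x'e x'l.
have ef : e != f by apply/eqP => h; rewrite h ltnn in fe.
have eX' : e \in X :\ f by rewrite !inE ef.
have after k : (e < k)%N -> psum X x k = psum (X :\ f) x' k.
  by move=> ek; apply/eqP; rewrite -subr_eq0 (psum_after fX eX fe x'l) // x'e subrr.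
have afterB (B : {set 'I_n}) k : f \notin B ->
    psum X (charf B) k = psum (X :\ f) (charf B) k.
  by move=> fB; rewrite (psumD1 _ _ fX) /charf (negPf fB); case: ifP; rewrite add0r.
have atE : psum X x e.+1 = x f + x e.
  by rewrite psumS eX (psum_before _ fX first) // fe.
have notboth B : wbase X x B -> f \in B -> e \notin B.
  case/wbaseP=> sB h _ fB; apply/negP => eB; have := h e.+1.
  rewrite atE psumS eX (psum_before _ fX first) // fe /charf fB eB ltr_norml /=; lra.
have same B : f \notin B -> B \subset X -> wbase (X :\ f) x' B = wbase X x B.
  move=> fB sB; have sB' : B \subset X :\ f.
    apply/subsetP => i iB; rewrite !inE (subsetP sB) // andbT.
    by apply: contraNneq fB => <-.
  apply/wbaseP/wbaseP => -[_ h1 h2]; split=> //.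
  - move=> k; rewrite afterB //; case: (leqP k e) => ke; last by rewrite after.
    rewrite (psum_before _ fX first) // (psum_before' first) //.
    by case: ifP => _; rewrite sub0r normrN; [rewrite gtr0_norm; lra | rewrite normr0].
  - move=> l lX; case: (eqVneq l f) => [->|lf].
      by rewrite /charf (negPf fB) sub0r normrN gtr0_norm; lra.
    case: (eqVneq l e) => [->|le].
      by rewrite /charf; case: (_ \in B); rewrite ltr_norml /=; lra.
    by rewrite -x'l //; apply: h2; rewrite !inE lf.
  - move=> k; have := h1 k; rewrite afterB //.
    case: (leqP k e) => ke; last by rewrite after.
    by rewrite !(psum_before' first) // subrr normr0.
  - move=> l; rewrite !inE => /andP[lf lX].
    case: (eqVneq l e) => [->|le]; last by rewrite x'l //; apply: h2.
    have := h1 e.+1; rewrite afterB // after // !psumS eX' !(psum_before' first) //.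
    by rewrite !add0r.
(* Between [f] and [e] the count drops from 1 to 0, which is still within distance 1 of the prefix
   sum [x f]. *)
have swap B : wbase X x B -> f \in B -> wbase X x (e |: B :\ f).
  move=> hB fB; have eB := notboth _ hB fB; case/wbaseP: hB => sB h1 h2.
  have sC : e |: B :\ f \subset X.
    apply/subsetP => i; rewrite !inE => /orP[/eqP->//|/andP[_]].
    exact: (subsetP sB).
  apply/wbaseP; split=> // [k|l lX].
    have eqn : psum X (charf (e |: B :\ f)) k + (f < k)%:R =
        psum X (charf B) k + (e < k)%:R.
      by rewrite !psum_charf // -!natrD cnt_swap.
    have := h1 k; move: eqn; case: (ltnP e k) => ek.
      by rewrite (ltn_trans fe ek) => /addIr ->.
    have := psum_before x fX first ek.
    have := psum_before (charf B) fX first ek.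
    rewrite {2}/charf fB; case: (f < k)%N => /= -> -> /= eqn _;
      rewrite ltr_norml; lra.
  have := h2 l lX; rewrite /charf !inE.
  case: (eqVneq l e) => [->|le] /= h; first by rewrite ltr_norml; lra.
  by case: (eqVneq l f) h => [-> _|lf] //=; rewrite ltr_norml; lra.
(* With the shift [1 - x f] the rounded count reaches 1 right after [f]. *)
have [Bf hBf fBf] : exists2 B, wbase X x B & f \in B.
  have [|B hB cB] := @rounding_base X x (1 - x f) wx; first lra.
  exists B => //; have := cB f.+1 (ltn_ord f).
  rewrite !psumS fX !(psum_before _ fX first) ?ltnn ?(ltnW fe) //.
  rewrite !add0r addrC subrK floor1 /charf.
  by case: (f \in B) => //= /eqP; rewrite eq_sym oner_eq0.
exists e, f; split=> //; first by rewrite gM.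
  apply/minsetP; split.
    rewrite inE gM; apply/andP; split.
      by apply/subsetP => i; rewrite !inE => /orP[]/eqP->.
    apply/negP => /exists_inP[B]; rewrite bM => hB.
    rewrite subUset !sub1set => /andP[eB fB].
    by have := notboth B hB fB; rewrite eB.
  move=> C; rewrite inE => /andP[_ dep] sC.
  apply/eqP; rewrite eqEsubset sC /=; apply: contraR dep => nsub.
  apply/exists_inP.
  have [fC|fC] := boolP (f \in C).
    have eC : e \notin C.
      apply: contra nsub => eC; rewrite subUset !sub1set eC fC //.
    exists Bf; rewrite ?bM //; apply/subsetP => i iC.
    have := subsetP sC i iC; rewrite !inE => /orP[]/eqP ei; last by rewrite ei.
    by rewrite ei in iC; rewrite iC in eC.
  exists (e |: Bf :\ f); first by rewrite bM swap.
  apply/subsetP => i iC; have := subsetP sC i iC.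
  rewrite !inE => /orP[]/eqP ei; rewrite ei ?eqxx //.
  by rewrite ei in iC; rewrite iC in fC.
split=> [|I]; first by rewrite gM gN.
apply/exists_inP/andP => [[B]|[/exists_inP[B]]].
  rewrite bN => hB sI; have sB : B \subset X :\ f by case/wbaseP: hB.
  have fB : f \notin B.
    by apply/negP => /(subsetP sB); rewrite !inE eqxx.
  split; last by apply: contra fB; apply: (subsetP sI).
  apply/exists_inP; exists B => //; rewrite bM -same //.
  by apply: subset_trans sB _; apply: subsetDl.
rewrite bM => hB sI fI; have sB : B \subset X by case/wbaseP: hB.
have [fB|fB] := boolP (f \in B); last by exists B; rewrite ?bN ?same.
(* A basis through [f] that covers [I] still covers it after the trade, as [f] is not in [I]. *)
have hC := swap B hB fB; exists (e |: B :\ f).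
  rewrite bN same //; last by case/wbaseP: hC.
  by rewrite !inE eqxx /= orbF eq_sym.
apply/subsetP => i iI; rewrite !inE (subsetP sI) // andbT.
by case: (eqVneq i f) iI => [->|] //; rewrite ?orbT //; rewrite (negPf fI).
Qed.

Lemma weight_cases X x l : weighting X x -> l \in X ->
  x l \is a Num.int -> x l = 0 \/ x l = 1.
Proof.
move=> [x01 _] lX i; have := x01 l lX => h.
have i0 : (0 : R) \is a Num.int by apply: rpred0.
by have := int_step i0 i; rewrite !add0r; apply; lra.
Qed.

Lemma weight_lt01 X x l : weighting X x -> l \in X ->
  x l \isn't a Num.int -> 0 < x l < 1.
Proof.
move=> [x01 _] lX i; have := x01 l lX => /andP[]; rewrite !le_eqVlt.
case/orP => [/eqP e|->]; first by rewrite -e rpred0 in i.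
by case/orP => [/eqP e|->] //; rewrite e rpred1 in i.
Qed.

Lemma singleton_series_parallel e x M : weighting [set e] x ->
  x e \is a Num.int -> has_weights M [set e] x -> series_parallel M.
Proof.
move=> wx xi [gM bM].
have hb B : (B \in bases M) = (B \subset [set e]) && (charf B e == x e).
  rewrite bM; apply/wbaseP/andP => [[sB _ h2]|[sB /eqP eB]]; split=> //.
  - by apply/eqP/int_near_eq; rewrite ?charf_int //; apply: h2; apply: set11.
  - move=> k; have -> : psum [set e] (charf B) k = psum [set e] x k.
      by apply: eq_psum => l; rewrite inE => /eqP-> _.
    by rewrite subrr normr0.
  - by move=> l; rewrite inE => /eqP->; rewrite eB subrr normr0.
case: (weight_cases wx (set11 e) xi) => xe.
  apply: (@SP_loop _ M e) => //; apply/setP => B; rewrite hb xe inE subset1 /charf.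
  case: (eqVneq B [set e]) => [->|_] /=.
    rewrite set11 oner_eq0; apply/esym/eqP => /setP/(_ e); by rewrite !inE eqxx.
  by case: (eqVneq B set0) => [->|] //=; rewrite inE eqxx.
apply: (@SP_coloop _ M e) => //; apply/setP => B; rewrite hb xe inE subset1 /charf.
case: (eqVneq B [set e]) => [->|_] /=; first by rewrite set11 eqxx.
by case: (eqVneq B set0) => [->|] //=; rewrite inE eq_sym oner_eq0.
Qed.

(** At each cut between two elements of [X] only two consecutive counts are allowed, so the lattice
    paths fill a border strip: these are the snake matroids. *)
Definition snake X x :=
  [/\ forall l, l \in X -> 0 < x l < 1,
      X != set0%SET,
      psum X x n \is a Num.int
    & forall k l l', l \in X -> l' \in X -> (l < k <= l')%N ->
        psum X x k \isn't a Num.int].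

Lemma snake_weighting X x : snake X x -> weighting X x.
Proof. by case=> h _ i _; split=> // l /h; lra. Qed.

(* The first two elements are parallel or in series, according as the sum of
   their weights is below or above [1]; merging them leaves a snake. *)
Lemma snake_series_parallel X x M : snake X x -> has_weights M X x ->
  series_parallel M.
Proof.
(* The singleton of weight 1 joins the induction because merging a two-element snake gives a coloop,
   which is not a snake. *)
have : forall X x M, snake X x \/ (exists2 e, X = [set e]%SET & x e = 1) ->
    has_weights M X x -> series_parallel M; last by move=> h sn; apply: h; left.
move=> {}X {}x {}M; move: {2}#|X| (leqnn #|X|) => m.
elim: m X x M => [|m IH] X x M cX.
  move: cX; rewrite leqn0 cards_eq0 => /eqP-> [[_ /eqP]|[e /setP/(_ e)]] //.
  by rewrite !inE eqxx.
case=> [sn|[e -> xe]]; last first.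
  apply: singleton_series_parallel; last by rewrite xe rpred1.
  split=> [l|]; first by rewrite inE => /eqP->; rewrite xe ler01 lexx.
  by rewrite psum_int // => l; rewrite inE => /eqP->; rewrite xe rpred1.
have wx := snake_weighting sn.
case: sn => x01 /set0Pn[f0 f0X] xint cuts wM.
have [f fX' fmin] := arg_minnP (fun i : 'I_n => i : nat) f0X.
have fX : f \in X by [].
have [e0 e0X] : exists e, e \in X :\ f.
  apply/set0Pn/negP => /eqP X0; have := xint.
  rewrite (psumD1 _ _ fX) X0 ltn_ord (_ : psum set0 x n = 0); last first.
    by apply: psum_eq0 => l; rewrite inE.
  rewrite addr0 => fi; have := x01 f fX => b.
  have : x f = 0 by apply: int_near_eq; rewrite ?rpred0 // subr0 ltr_norml; lra.
  by lra.
have [e eXf' emin] := arg_minnP (fun i : 'I_n => i : nat) e0X.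
have eXf : e \in X :\ f by [].
have /setD1P[ef eX] := eXf.
have fe : (f < e)%N.
  rewrite ltn_neqAle fmin // andbT; apply: contraNneq ef => h.
  by apply/eqP/val_inj.
have first l : l \in X -> l != f -> (e <= l)%N.
  by move=> lX lf; apply: emin; apply/setD1P.
have xf := x01 f fX; have xe := x01 e eX.
have atE : psum X x e.+1 = x f + x e.
  by rewrite psumS eX (psum_before _ fX first) // fe.
pose x1 s l := if l == e then s else x l.
have x1e s : x1 s e = s by rewrite /x1 eqxx.
have x1l s l : l \in X -> l != f -> l != e -> x1 s l = x l.
  by move=> _ _ /negPf le; rewrite /x1 le.
have cX' : (#|X :\ f| <= m)%N by move: cX; rewrite (cardsD1 f) fX add1n ltnS.
have int_after s k : x f + x e - s \is a Num.int -> (e < k)%N ->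
    (psum (X :\ f) (x1 s) k \is a Num.int) = (psum X x k \is a Num.int).
  move=> si ek; have e1 := psum_after fX eX fe (x1l s) ek.
  rewrite x1e in e1; rewrite -e1 in si.
  by rewrite -[psum X x k](subrK (psum (X :\ f) (x1 s) k)) rpredDl.
have snake' s : x f + x e - s \is a Num.int -> 0 < s < 1 -> snake (X :\ f) (x1 s).
  move=> si s01; split.
  - by move=> l; rewrite !inE /x1 => /andP[_ lX]; case: eqP => // _; apply: x01.
  - by apply/set0Pn; exists e.
  - by rewrite int_after.
  - move=> k l l'; rewrite !inE => /andP[lf lX] /andP[_ l'X] /andP[lk kl'].
    rewrite int_after //; last by apply: leq_ltn_trans lk; apply: first.
    by apply: (cuts k l l') => //; rewrite lk.
have [X'e|] := eqVneq (X :\ f) [set e]%SET.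
  (* The total weight is an integer strictly between 0 and 2. *)
  have s1 : x f + x e = 1.
    have : psum X x n = x f + x e.
      rewrite (psumD1 _ _ fX) X'e ltn_ord /psum big_mkcondr big_set1 ltn_ord //.
    move=> h; rewrite h in xint; apply: int_near_eq; rewrite ?rpred1 //.
    by rewrite ltr_norml; lra.
  have [|N wN] := @weights_matroid (X :\ f) (x1 1).
    split=> [l|]; last by rewrite int_after // s1 subrr rpred0.
    by rewrite X'e inE /x1 => ->; lra.
  apply: (@SP_parallel _ N).
    by apply: IH wN => //; right; exists e; rewrite // x1e.
  apply: (parallel_weights wM wN wx fX eX fe first) => //; rewrite ?x1e; try lra.
  exact: x1l.
move=> nX'; have [e' e'X' e'e] : exists2 e', e' \in X :\ f & e' != e.
  apply/exists_inP; apply: contraR nX' => /exists_inPn h.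
  rewrite eqEsubset sub1set eXf andbT; apply/subsetP => i /h.
  by rewrite negbK inE.
have /setD1P[e'f e'X] := e'X'.
have s_nint : x f + x e \isn't a Num.int.
  rewrite -atE; apply: (cuts e.+1 e e') => //; rewrite ltnSn /=.
  by rewrite ltn_neqAle first // andbT; apply: contraNneq e'e => h; apply/eqP/val_inj.
have [s_lt|s_gt|s1] := ltrgtP (x f + x e) 1; last by rewrite s1 rpred1 in s_nint.
  have sn' : snake (X :\ f) (x1 (x f + x e)).
    by apply: snake'; rewrite ?subrr ?rpred0 //; lra.
  have [N wN] := weights_matroid (snake_weighting sn').
  apply: (@SP_parallel _ N); first by apply: IH wN => //; left.
  apply: (parallel_weights wM wN wx fX eX fe first) => //; rewrite ?x1e; try lra.
  exact: x1l.
have sn' : snake (X :\ f) (x1 (x f + x e - 1)).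
  by apply: snake'; last lra; rewrite opprB addrCA subrr addr0 rpred1.
have [N wN] := weights_matroid (snake_weighting sn').
apply: (@SP_series _ N); first by apply: IH wN => //; left.
have wx' : weighting X (fun l => 1 - x l).
  split=> [l /x01|]; first by lra.
  rewrite psum_opp rpredB // psum_int // => l _; exact: rpred1.
(* The dual weights [1 - x f] and [1 - x e] sum to less than 1, and their sum is 1 minus the merged
   weight. *)
apply: (parallel_weights (dual_weights wM) (dual_weights wN) wx' fX eX fe first);
  rewrite ?x1e //; try lra.
by move=> l lX lf le; rewrite x1l.
Qed.

End WeightedMatroids.

(** * Circuits, direct sums and connectivity *)

Section DirectSums.
Variable T : finType.
Implicit Types (M N : matroid T) (B C X Y : {set T}).

(** If a circuit left [X], every block would cut out a proper, hence independent, part of it.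
    Gluing, block by block, bases that cover these parts would give a basis containing the
    circuit. *)
Lemma circuit_in_block P F N C X e : is_direct_sum P F N -> circuit N C ->
  X \in P -> e \in X -> e \in C -> C \subset X.
Proof.
case=> partP _ sumB /minsetP[/andP[sC dep] minC] XP eX eC.
have /and3P[/eqP covP trivP _] := partP.
apply/negPn/negP => /subsetPn[f fC fX].
have inC Y : Y \in P -> exists2 B, B \in bases N & C :&: Y \subset B.
  move=> YP; case: (boolP (indep N (C :&: Y))) => [/exists_inP //|depY].
  have eCY : C :&: Y = C.
    apply: minC; last exact: subsetIl.
    rewrite inE depY andbT; apply: subset_trans sC; exact: subsetIl.
  have sCY : C \subset Y by rewrite -eCY subsetIr.
  have eXY : X = Y.
    have eY := subsetP sCY e eC.
    by rewrite -(def_pblock trivP XP eX) (def_pblock trivP YP eY).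
  by rewrite eXY (subsetP sCY) in fX.
pose b Y := odflt set0 [pick B in bases N | C :&: Y \subset B].
have bP Y : Y \in P -> b Y \in bases N /\ C :&: Y \subset b Y.
  move=> /inC[B hB sB]; rewrite /b; case: pickP => [D /andP[]//|/(_ B)].
  by rewrite hB sB.
pose D := \bigcup_(Y in P) (b Y :&: Y).
have DY Y : Y \in P -> D :&: Y = b Y :&: Y.
  move=> YP; apply/setP => i; rewrite !inE; apply/andP/andP => [[]|[ib iY]].
    case/bigcupP => Z ZP; rewrite inE => /andP[iZ iZ'] iY; split=> //.
    suff -> : Y = Z by [].
    by rewrite -(def_pblock trivP YP iY) (def_pblock trivP ZP iZ').
  by split=> //; apply/bigcupP; exists Y; rewrite // inE ib.
move: dep => /negP; apply; apply/exists_inP; exists D.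
  rewrite sumB; apply/andP; split.
    apply/bigcupsP => Y YP; apply: subset_trans (subsetIr _ _) _.
    by rewrite -covP; apply: bigcup_sup.
  apply/forall_inP => Y YP; rewrite DY //; have [+ _] := bP Y YP.
  by rewrite sumB => /andP[_ /forall_inP]; apply.
apply/subsetP => i iC; have : i \in cover P by rewrite covP (subsetP sC).
case/bigcupP => Y YP iY; apply/bigcupP; exists Y => //; rewrite inE iY andbT.
by have [_ /subsetP] := bP Y YP; apply; rewrite inE iC.
Qed.

(** This is the fundamental circuit: a minimal dependent subset of [f |: B] contains [f] because [B]
    is independent, and [e] because the swapped set is. *)
Lemma swap_same_component N B e f : B \in bases N -> e \in B -> f \notin B ->
  f |: B :\ e \in bases N -> same_component N e f.
Proof.
move=> hB eB fB hC; rewrite /same_component.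
have dep : ~~ indep N (f |: B).
  apply/negP => /exists_inP[D hD /subset_leq_card].
  by rewrite cardsU1 fB (bases_card hB hD) add1n ltnn.
have sg : f |: B \subset ground N.
  rewrite subUset (bases_ground hB) andbT; apply: subset_trans (bases_ground hC).
  exact: subsetUl.
have [|C cC sC] := @minset_exists _
    [pred X : {set T} | (X \subset ground N) && ~~ indep N X] (f |: B).
  by rewrite inE sg.
apply/orP; right; apply/existsP; exists C; rewrite /circuit cC /=.
have /minsetP[/andP[_ depC] _] := cC.
apply/andP; split; apply: contraR depC => nC; apply/exists_inP.
  exists (f |: B :\ e) => //; apply/subsetP => i iC.
  have := subsetP sC i iC; rewrite !inE => /orP[->//|iB].
  by rewrite iB andbT; case: (eqVneq i e) iC nC => [-> ->|_] //; rewrite orbT.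
exists B => //; apply/subsetP => i iC.
have := subsetP sC i iC; rewrite !inE => /orP[/eqP ei|//].
by rewrite -ei iC in nC.
Qed.

Lemma same_componentC N e f : same_component N e f = same_component N f e.
Proof.
rewrite /same_component eq_sym; congr (_ || _).
by apply: eq_existsb => C; rewrite [(e \in C) && _]andbC.
Qed.

End DirectSums.

(** * Splitting a weighted matroid along its integral cuts *)

Section Blocks.
Local Open Scope ring_scope.
Variables (R : realType) (n : nat).
Variable x : 'I_n -> R.
Implicit Types (X B : {set 'I_n}) (v : 'I_n -> R) (M N : matroid 'I_n).
Hypothesis wx : weighting [set: 'I_n] x.

Notation S := (psum [set: 'I_n]).

(** Elements with the same value lie between the same two consecutive integral cuts, so the value
    names their run. *)
Fixpoint last_cut (k : nat) : nat :=
  if S x k \is a Num.int then k else if k is j.+1 then last_cut j else 0%N.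

Lemma last_cut_le k : (last_cut k <= k)%N.
Proof. by elim: k => [|k IH] /=; case: ifP => // _; apply: leqW. Qed.

Lemma last_cut_int k : S x (last_cut k) \is a Num.int.
Proof. by elim: k => [|k IH] /=; case: ifP => // _; rewrite psum0 rpred0. Qed.

Lemma last_cut_after k j : (last_cut k < j <= k)%N -> S x j \isn't a Num.int.
Proof.
elim: k => [|k IH] /=; first by case: ifP => _; case: j.
case: ifPn => [_|ni]; first by case/andP => /leq_trans h /h; rewrite ltnn.
by case: (eqVneq j k.+1) => [-> //|jk] h; apply: IH; lia.
Qed.

Lemma last_cut_unique i k : (i <= k)%N -> S x i \is a Num.int ->
  (forall j, (i < j <= k)%N -> S x j \isn't a Num.int) -> last_cut k = i.
Proof.
elim: k => [|k IH] ik ii nj /=; first by case: ifP => _; lia.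
case: (ltnP i k.+1) => ik1; last first.
  have -> : k.+1 = i by lia.
  by rewrite ii.
rewrite (negPf (nj k.+1 _)) ?ik1 ?leqnn //; apply: IH => // j jk.
by apply: nj; lia.
Qed.

Lemma last_cut_id k : S x k \is a Num.int -> last_cut k = k.
Proof. by move=> h; case: k h => [|k] /= ->. Qed.

(** The end [j] is [k] while the run starting at [i] is open, and the next cut once it is closed. It
    is chosen before [v], so that one formula serves the weights and all bases. *)
Lemma sum_last_cut i k : S x i \is a Num.int -> (i <= k <= n)%N ->
  exists2 j, (if last_cut k == i then j = k else S x j \is a Num.int) &
    forall v, \sum_(l : 'I_n | (last_cut l == i) && (l < k)%N) v l = S v j - S v i.
Proof.
move=> ii; elim: k => [|k IH] ikn.
  have -> : i = 0%N by lia.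
  exists 0%N; first by case: ifP => // _; rewrite psum0 rpred0.
  by move=> v; rewrite subrr big1 // => l; rewrite andbF.
case: (eqVneq i k.+1) => [ik|ik].
  exists k.+1; first by case: ifP => // _; rewrite -ik.
  move=> v; rewrite ik subrr big1 // => l /andP[/eqP e lk].
  by have := last_cut_le l; lia.
have kn : (k < n)%N by lia.
have [|j hj sj] := IH; first by lia.
have recr v : \sum_(l : 'I_n | (last_cut l == i) && (l < k.+1)%N) v l =
    \sum_(l : 'I_n | (last_cut l == i) && (l < k)%N) v l +
    (if last_cut k == i then v (Ordinal kn) else 0).
  case: ifPn => lc.
    rewrite (bigD1 (Ordinal kn)) /= ?lc ?leqnn // addrC; congr (_ + _).
    apply: eq_bigl => l; rewrite -andbA; congr (_ && _).
    have -> : (l != Ordinal kn) = (l != k :> nat) by [].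
    by rewrite ltnS andbC -ltn_neqAle.
  rewrite addr0; apply: eq_bigl => l; rewrite ltnS leq_eqVlt.
  by case: (eqVneq (l : nat) k) => //= ->; rewrite (negPf lc).
have [lc|lc] := eqVneq (last_cut k) i.
  exists k.+1.
    case: ifPn => // lc1; apply/negPn/negP => ni; case/negP: lc1; apply/eqP.
    by rewrite /= (negPf ni).
  move=> v; rewrite recr sj lc eqxx; rewrite lc eqxx in hj.
  by rewrite (psumS _ _ (Ordinal kn)) hj in_setT /=; ring.
exists j; last by move=> v; rewrite recr sj (negPf lc) addr0.
rewrite (negPf lc) in hj; rewrite ifN //=; case: ifP => _.
  by rewrite eq_sym.
exact: lc.
Qed.

(** Integral quantities leave no choice in rounding, so every basis shares them with [x]; block sums
    need to know nothing more about a vector. *)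
Definition compatible v :=
  (forall l, x l \is a Num.int -> v l = x l) /\
  (forall k, S x k \is a Num.int -> S v k = S x k).

Lemma compatible_refl : compatible x. Proof. by []. Qed.

Lemma compatible_base B : wbase [set: 'I_n] x B -> compatible (charf R B).
Proof.
case/wbaseP => _ h1 h2; split=> [l i|k i]; apply: int_near_eq => //.
- exact: charf_int.
- exact: h2.
- exact: psum_charf_int.
Qed.

(** The boolean keeps labels of singletons apart from cut positions. An integral element is split
    off from its run, and the rest of the run stays one block. *)
Definition block_label (l : 'I_n) : bool * nat :=
  if x l \is a Num.int then (true, l : nat) else (false, last_cut l).

Definition blocks := preim_partition block_label [set: 'I_n].

Lemma blocks_partition : partition blocks [set: 'I_n].
Proof. exact: preim_partitionP. Qed.

Lemma blockP X : X \in blocks ->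
  (exists2 l, x l \is a Num.int & X = [set l]) \/
  (exists l, [/\ l \in X, x l \isn't a Num.int &
     X = [set l' : 'I_n | (x l' \isn't a Num.int) && (last_cut l' == last_cut l)]]).
Proof.
case/imsetP => l _ ->; case: (boolP (x l \is a Num.int)) => xl; [left|right].
  exists l => //; apply/setP => l'; rewrite !inE /block_label xl /=.
  case: ifP => xl'; first by rewrite xpair_eqE eq_sym.
  by rewrite xpair_eqE; apply/esym/eqP => e; rewrite e xl in xl'.
exists l; split=> //; first by rewrite !inE eqxx.
apply/setP => l'; rewrite !inE /block_label (negPf xl).
by case: ifP => xl' //=; rewrite xpair_eqE eq_sym.
Qed.

(** The integer [z] does not depend on [v], so a deviation inside a block is a deviation of some
    global prefix sum. By the last clause only one block can be open at [k]; in all others the sum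
    is frozen at an integer. *)
Lemma block_psum X k : X \in blocks -> (k <= n)%N ->
  exists j z, [/\ z \is a Num.int,
     forall v, compatible v -> psum X v k = S v j - z
   & if X == [set l : 'I_n | (x l \isn't a Num.int) && (last_cut l == last_cut k)]
     then j = k else S x j \is a Num.int].
Proof.
move=> Xb kn; case: (blockP Xb) => [[l xl eX]|[l [lX xl eX]]].
  exists 0%N, (- (if (l < k)%N then x l else 0)); split.
  - by rewrite rpredN; case: ifP => //; rewrite rpred0.
  - move=> v [v1 _]; rewrite psum0 sub0r opprK eX /psum big_mkcondr big_set1.
    by rewrite v1.
  - rewrite psum0 rpred0 ifN //; apply/eqP => /setP/(_ l).
    by rewrite eX !inE eqxx xl.
set i := last_cut l in eX; have ii : S x i \is a Num.int by apply: last_cut_int.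
have Xk : (X == [set l' : 'I_n |
    (x l' \isn't a Num.int) && (last_cut l' == last_cut k)]) = (last_cut k == i).
  apply/eqP/eqP => [/setP/(_ l)|->] //; rewrite lX inE xl /= => /esym/eqP //.
rewrite Xk; case: (leqP i k) => ik; last first.
  exists 0%N, 0; split; rewrite ?rpred0 //; last first.
    rewrite psum0 rpred0; case: eqP => // e; have := last_cut_le k; lia.
  move=> v _; rewrite psum0 subr0 psum_eq0 // => l'; rewrite eX inE => /andP[_ /eqP e].
  by have := last_cut_le l'; lia.
have [|j hj sj] := sum_last_cut ii (k := k); first by rewrite ik.
(* The integral elements of the run are blocks of their own, and [w] takes them out. *)
pose w := \sum_(l' : 'I_n |
  (last_cut l' == i) && (l' < k)%N && (x l' \is a Num.int)) x l'.
exists j, (S x i + w); split=> // [|v [v1 v2]].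
  by rewrite rpredD // rpred_sum // => l' /andP[].
rewrite opprD addrA -(v2 _ ii) -sj (bigID (fun l' => x l' \is a Num.int)) /=.
have -> : w = \sum_(l' : 'I_n |
    (last_cut l' == i) && (l' < k)%N && (x l' \is a Num.int)) v l'.
  by apply: eq_bigr => l' /andP[_ /v1].
rewrite addrAC subrr add0r; apply: eq_bigl => l'.
by rewrite eX inE [RHS]andbC andbA.
Qed.

Lemma block_weighting X : X \in blocks -> weighting X x.
Proof.
move=> Xb; split=> [l _|]; first by have [h _] := wx; apply: h; rewrite inE.
have [j [z [zi /(_ _ compatible_refl) -> hj]]] := block_psum Xb (leqnn n).
by rewrite rpredB //; case: ifP hj => // _ ->; case: wx.
Qed.

Lemma block_series_parallel X M : X \in blocks -> has_weights M X x ->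
  series_parallel M.
Proof.
move=> Xb hM; have wX := block_weighting Xb.
case: (blockP Xb) => [[l xl eX]|[l [lX xl eX]]].
  by rewrite eX in wX hM; apply: singleton_series_parallel hM.
apply: snake_series_parallel hM; have [_ xint] := wX; split=> //.
- move=> l' l'X; have xl' : x l' \isn't a Num.int.
    by move: l'X; rewrite eX inE => /andP[].
  exact: weight_lt01 wX l'X xl'.
- by apply/set0Pn; exists l.
move=> k l1 l2; rewrite eX !inE => /andP[_ /eqP e1] /andP[_ /eqP e2] /andP[l1k kl2].
have kn : (k <= n)%N by apply: leq_trans kl2 (ltnW _).
have ni : S x k \isn't a Num.int.
  by apply: (@last_cut_after l2); rewrite e2 -e1 kl2 (leq_ltn_trans (last_cut_le _) l1k).
have lk : last_cut k = last_cut l.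
  apply: last_cut_unique; rewrite ?last_cut_int //.
    by rewrite -e1 (leq_trans (last_cut_le _) (ltnW l1k)).
  by move=> j /andP[j1 j2]; apply: (@last_cut_after l2); rewrite e2 j1 (leq_trans j2).
rewrite -eX; have [j [z [zi /(_ _ compatible_refl) -> hj]]] := block_psum Xb kn.
move: hj; rewrite lk -eX eqxx => ->.
by apply: contra ni => h; rewrite -(subrK z (S x k)) rpredD.
Qed.

Lemma psum_blocks v k : S v k = \sum_(X in blocks) psum X v k.
Proof.
have /and3P[/eqP cov triv _] := blocks_partition.
rewrite /psum big_mkcondr /= -cov big_trivIset //; apply: eq_bigr => X _.
by rewrite big_mkcondr.
Qed.

(** From blocks to the whole: at each position all blocks but the open one agree with [x] exactly,
    so the total deviation is that of a single block. *)
Lemma wbase_blocks B :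
  wbase [set: 'I_n] x B = [forall X in blocks, wbase X x (B :&: X)].
Proof.
have charI X l : l \in X -> charf R (B :&: X) l = charf R B l.
  by move=> lX; rewrite /charf inE lX andbT.
have psumI X k : psum X (charf R (B :&: X)) k = psum X (charf R B) k.
  by apply: eq_psum => l lX _; apply: charI.
apply/idP/forall_inP => [hB X Xb|h].
  have cB := compatible_base hB; case/wbaseP: hB => _ h1 h2.
  apply/wbaseP; split; first exact: subsetIr.
    move=> k; wlog kn : k / (k <= n)%N.
      move=> H; case: (leqP k n) => [/H //|/ltnW nk].
      by rewrite !(psum_ge _ _ nk); apply: H.
    have [j [z [_ hz _]]] := block_psum Xb kn.
    rewrite psumI !hz //; have := h1 j.
    by have -> : S (charf R B) j - z - (S x j - z) = S (charf R B) j - S x j by ring.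
  by move=> l lX; rewrite charI //; apply: h2; rewrite inE.
have /and3P[/eqP cov triv _] := blocks_partition.
apply/wbaseP; split; first exact: subsetT.
  move=> k; wlog kn : k / (k <= n)%N.
    move=> H; case: (leqP k n) => [/H //|/ltnW nk].
    by rewrite !(psum_ge _ _ nk); apply: H.
  rewrite !psum_blocks -sumrB.
  pose X0 := [set l : 'I_n | (x l \isn't a Num.int) && (last_cut l == last_cut k)].
  have zero X : X \in blocks -> X != X0 -> psum X (charf R B) k - psum X x k = 0.
    move=> Xb XX0; have /wbaseP[_ /(_ k) h1 _] := h X Xb.
    rewrite psumI in h1.
    have [j [z [zi /(_ _ compatible_refl) hz]]] := block_psum Xb kn.
    rewrite (negPf XX0) => ji.
    apply/eqP; rewrite subr_eq0; apply/eqP/int_near_eq => //.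
      exact: psum_charf_int.
    by rewrite hz rpredB.
  case: (boolP (X0 \in blocks)) => X0b; last first.
    rewrite big1 ?normr0 // => X Xb; apply: zero => //.
    by apply: contraNneq X0b => <-.
  rewrite (bigD1 X0) //= big1 ?addr0; last by move=> X /andP[]; apply: zero.
  by have /wbaseP[_ /(_ k) + _] := h X0 X0b; rewrite psumI.
move=> l _; have : l \in cover blocks by rewrite cov inE.
case/bigcupP => X Xb lX; have /wbaseP[_ _ /(_ l lX)] := h X Xb.
by rewrite charI.
Qed.

Lemma weights_direct_sum N : has_weights N [set: 'I_n] x ->
  exists F, is_direct_sum blocks F N /\
    forall X, X \in blocks -> series_parallel (F X).
Proof.
case=> gN bN.
have [F hF] : exists F : {set 'I_n} -> matroid 'I_n,
    forall X, X \in blocks -> has_weights (F X) X x.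
  have /boolp.choice[F hF] : forall X, exists M, X \in blocks -> has_weights M X x.
    move=> X; case: (boolP (X \in blocks)) => Xb; last by exists N.
    by have [M hM] := weights_matroid (block_weighting Xb); exists M.
  by exists F.
exists F; split; last by move=> X Xb; apply: block_series_parallel (hF X Xb).
split; first by rewrite gN; apply: blocks_partition.
  by move=> X /hF[].
move=> B; rewrite bN wbase_blocks gN subsetT /=.
by apply: eq_forallb => X; case: (boolP (X \in blocks)) => //= /hF[_ ->].
Qed.

Lemma weights_series_parallel_sum N : has_weights N [set: 'I_n] x ->
  direct_sum_of_series_parallel N.
Proof. by move=> /weights_direct_sum[F [h1 h2]]; exists blocks, F. Qed.

End Blocks.

(** * Connected components when no weight is integral *)

Section Components.
Local Open Scope ring_scope.
Variables (R : realType) (n : nat) (x : 'I_n -> R).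
Hypothesis wx : weighting [set: 'I_n] x.
Hypothesis x01 : forall l, 0 < x l < 1.

Notation S := (psum [set: 'I_n] x).

(* [B] follows [ceil S] between [e] and [f], so that exchanging [e] for [f]
   moves these counts down to [floor S]. *)
Lemma cut_free_swap (e f : 'I_n) : (e < f)%N ->
  (forall k, (e < k <= f)%N -> S k \isn't a Num.int) ->
  exists B, [/\ wbase [set: 'I_n] x B, e \in B, f \notin B
              & wbase [set: 'I_n] x (f |: B :\ e)].
Proof.
move=> ef ni.
pose fl k : R := (Num.floor (S k))%:~R; pose ce k : R := (Num.ceil (S k))%:~R.
have flP k : S k - 1 < fl k <= S k.
  by have := Num.Theory.floor_itv (S k); rewrite /fl intrD; lra.
have ceP k : S k <= ce k < S k + 1.
  by have := Num.Theory.ceil_itv (S k); rewrite /ce intrB; lra.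
have fli k : fl k \is a Num.int by apply: intr_int.
have cei k : ce k \is a Num.int by apply: intr_int.
have ce_fl k : (e < k <= f)%N -> ce k = fl k + 1.
  move=> /ni h; have flce : fl k <= ce k by have := flP k; have := ceP k; lra.
  have ce2 : ce k < fl k + 2 by have := flP k; have := ceP k; lra.
  have [ee|//] := int_step (fli k) (cei k) flce ce2.
  have eS : S k = fl k by have := flP k; have := ceP k; lra.
  by rewrite eS fli in h.
have x0 l : l \in [set: 'I_n] -> 0 <= x l by have := x01 l; lra.
have mono j k : (j <= k)%N -> S j <= S k by apply: le_psum.
have Sstep (l : 'I_n) : S l < S l.+1 < S l + 1.
  by rewrite psumS in_setT; have := x01 l; lra.
pose m := fl e.+1; pose p := ce f.
have mi : m \is a Num.int by apply: fli.
have pi : p \is a Num.int by apply: cei.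
(* The cap [m] up to [e] gives [g] the value [m] at [e], so that it steps up there and [e] enters
   [B]; the lower bound [p] beyond [f] holds [g] at [p] from [f] to [f.+1], so that [f] stays
   out. *)
pose g k := if (k <= e)%N then Num.min (ce k) m
            else if (k <= f)%N then ce k else Num.max (fl k) p.
have gi k : g k \is a Num.int.
  rewrite /g; case: (k <= e)%N; first by rewrite minElt; case: (_ < _).
  by case: (k <= f)%N; rewrite // maxElt; case: (_ < _).
have gnear k : S k - 1 < g k < S k + 1.
  have := flP k; have := ceP k; rewrite /g; case: (leqP k e) => ke.
    have := mono k e.+1 (leqW ke); have := flP e.+1; rewrite -/m.
    by rewrite minElt; case: (ltP (ce k) m) => ? *; lra.
  case: (leqP k f) => kf; first lra.
  have := mono f k (ltnW kf); have := ceP f; rewrite -/p.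
  by rewrite maxElt; case: (ltP (fl k) p) => ? *; lra.
have ge : g e = m.
  have := flP e.+1; have := ceP e; have := Sstep e; rewrite -/m => h1 h2 h3.
  have me : m <= ce e by apply: int_lt_le => //; lra.
  by rewrite /g leqnn; apply/min_idPr.
have ge1 : g e.+1 = m + 1 by rewrite /g ltnn ef ce_fl // leqnn.
have gf : g f = p by rewrite /g leqNgt ef leqnn.
have gf1 : g f.+1 = p.
  have := flP f.+1; have := ceP f; have := Sstep f; rewrite -/p => h1 h2 h3.
  have fp : fl f.+1 <= p by apply: int_lt_le => //; lra.
  by rewrite /g leqNgt (ltn_trans ef) //= ltnn; apply/max_idPr.
have gstep (l : 'I_n) : g l.+1 = g l \/ g l.+1 = g l + 1.
  have [->|le] := eqVneq l e; first by right; rewrite ge1 ge.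
  have [->|lf] := eqVneq l f; first by left; rewrite gf1 gf.
  have h0 := Sstep l; have h1 := flP l; have h2 := flP l.+1.
  have h3 := ceP l; have h4 := ceP l.+1.
  have c1 : ce l <= ce l.+1 by apply: int_lt_le => //; lra.
  have f1 : fl l <= fl l.+1 by apply: int_lt_le => //; lra.
  suff [i1 i2] : g l <= g l.+1 /\ g l.+1 < g l + 2 by apply: int_step.
  rewrite /g; case: (ltngtP l e) => hle; last by case/eqP: le; apply: val_inj.
    by rewrite !minElt; case: (ltP (ce l) m) => ?; case: (ltP (ce l.+1) m) => ?; lra.
  case: (ltngtP l f) => hlf.
  - by split; lra.
  - by rewrite !maxElt; case: (ltP (fl l) p) => ?; case: (ltP (fl l.+1) p) => ?; lra.
  - by case/eqP: lf; apply: val_inj.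
have g0 : g 0%N = 0.
  have := gnear 0%N; rewrite psum0 => h; apply: int_near_eq; rewrite ?rpred0 //.
  by rewrite ltr_norml; lra.
have [l _|l|B [sB cB eB]] := @set_of_counts R n [set: 'I_n] g g0.
- exact: gstep.
- by rewrite inE.
have elts (A : {set 'I_n}) l : `|charf R A l - x l| < 1.
  by rewrite /charf ltr_norml; have := x01 l; case: (l \in A) => /=; lra.
have eBe : e \in B.
  have := eB e (in_setT _); rewrite ge1 ge /charf; case: (e \in B) => //= h; lra.
have fB : f \notin B.
  have := eB f (in_setT _); rewrite gf1 gf /charf; case: (f \in B) => //= h; lra.
exists B; split=> //; apply/wbaseP; split; rewrite ?subsetT //.
  move=> k; wlog kn : k / (k <= n)%N.
    move=> H; case: (leqP k n) => [/H //|/ltnW nk].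
    by rewrite !(psum_ge _ _ nk); apply: H.
  by rewrite cB // ltr_norml; have := gnear k; lra.
move=> k; wlog kn : k / (k <= n)%N.
  move=> H; case: (leqP k n) => [/H //|/ltnW nk].
  by rewrite !(psum_ge _ _ nk); apply: H.
have eqn : psum [set: 'I_n] (charf R (f |: B :\ e)) k + (e < k)%:R =
    psum [set: 'I_n] (charf R B) k + (f < k)%:R.
  by rewrite !psum_charf ?subsetT // -!natrD cnt_swap.
move: eqn; rewrite cB // => eqn; rewrite ltr_norml.
have h1 := gnear k; case: (ltnP e k) eqn => ek; case: (ltnP f k) => kf /= eqn; try lra.
  have : g k = fl k + 1 by rewrite /g leqNgt ek kf /= ce_fl // ek.
  by have := flP k; lra.
by have := ltn_trans (leq_ltn_trans ek ef) kf; rewrite ltnn.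
Qed.

(** The blocks are now the whole runs between cuts: circuits stay inside a block, and within a run a
    swap of two elements yields a circuit through both. *)
Lemma same_component_cut N (e f : 'I_n) : has_weights N [set: 'I_n] x ->
  same_component N e f = (last_cut x e == last_cut x f).
Proof.
move=> hN; have [_ bN] := hN; apply/idP/eqP => [/orP[/eqP->//|]|].
  case/existsP => C /and3P[cC eC fC].
  have [F [hs _]] := weights_direct_sum wx hN.
  have eb : e \in cover (blocks x).
    by have /and3P[/eqP -> _ _] := blocks_partition x; rewrite inE.
  case/bigcupP: eb => X Xb eX.
  have fX := subsetP (circuit_in_block hs cC Xb eX eC) f fC.
  case: (blockP Xb) => [[l xl _]|[l [_ _ eqX]]].
    by have := x01 l; case: (weight_cases wx (in_setT l) xl) => ->; rewrite ltxx ?andbF.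
  by move: eX fX; rewrite eqX !inE => /andP[_ /eqP->] /andP[_ /eqP->].
wlog ef : e f / (e < f)%N.
  move=> H; case: (ltngtP e f) => [/H //|fe ee|ee _].
    by rewrite same_componentC; apply: H.
  by rewrite (val_inj ee : e = f) /same_component eqxx.
move=> ee; have [|B [hB eB fB hC]] := cut_free_swap ef.
  move=> k /andP[ek kf]; apply: (@last_cut_after _ _ x f); rewrite kf andbT -ee.
  exact: leq_ltn_trans (last_cut_le x e) ek.
by apply: (@swap_same_component _ N B); rewrite ?bN.
Qed.

(** A component is named by the integral cut at which it starts. The cut at 0 always counts, which
    makes the components one more than the cuts with 0 < k < n. *)
Lemma card_components_cuts N : has_weights N [set: 'I_n] x ->
  #|components N| = (\sum_(0 <= k < n) (S k \is a Num.int))%N.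
Proof.
move=> hN; have [gN _] := hN.
pose J := [set i : 'I_n | S i \is a Num.int].
pose cl (i : 'I_n) := [set f : 'I_n | last_cut x f == i].
have -> : components N = cl @: J.
  apply/setP => Y; apply/imsetP/imsetP => [[e _ ->]|[i iJ ->]].
    have ln : (last_cut x e < n)%N by apply: leq_ltn_trans (last_cut_le x e) _.
    exists (Ordinal ln); first by rewrite inE last_cut_int.
    by apply/setP => f; rewrite !inE gN inE (same_component_cut _ _ hN) eq_sym.
  exists i; first by rewrite gN inE.
  apply/setP => f; rewrite !inE gN inE (same_component_cut _ _ hN) eq_sym.
  by rewrite (@last_cut_id _ _ x i) //; rewrite inE in iJ.
rewrite card_in_imset; last first.
  move=> i j; rewrite !inE => iJ jJ /setP/(_ i); rewrite !inE last_cut_id //.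
  by rewrite eqxx => /esym/eqP h; apply: val_inj.
rewrite big_mkord -sum1_card big_mkcond; apply: eq_bigr => i _; rewrite inE.
by case: ifP.
Qed.

End Components.

(** * Conditions that hold for all small positive parameters *)

Section SmallParameter.
Local Open Scope ring_scope.
Variable R : realType.

Lemma small_pos (a b : R) : 0 < a ->
  exists2 d, 0 < d & forall t, 0 < t <= d -> 0 < a + t * b.
Proof.
move=> a0; have b1 : 0 < 1 + `|b| by rewrite ltr_pwDl.
exists (a / (1 + `|b|)); first by rewrite divr_gt0.
move=> t /andP[t0]; rewrite ler_pdivlMr // => h.
have : t * - b <= t * `|b| by rewrite ler_pM2l // -normrN ler_norm.
by move: h; rewrite mulrDr mulr1 mulrN; lra.
Qed.

Lemma small_all (I : finType) (P : I -> R -> Prop) :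
  (forall i, exists2 d, 0 < d & forall t, 0 < t <= d -> P i t) ->
  exists2 d, 0 < d & forall t, 0 < t <= d -> forall i, P i t.
Proof.
move=> h; suff [d d0 hd] : exists2 d, 0 < d & forall t, 0 < t <= d ->
    forall i, i \in enum I -> P i t.
  by exists d => // t /hd H i; apply: H; rewrite mem_enum.
elim: (enum I) => [|j s [d d0 hd]]; first by exists 1.
have [d' d'0 hd'] := h j; exists (Num.min d d').
  by rewrite lt_min d0.
move=> t /andP[t0]; rewrite le_min => /andP[td td'] i.
rewrite inE => /orP[/eqP->|]; first by apply: hd'; rewrite t0.
by apply: hd; rewrite t0.
Qed.

End SmallParameter.

Section Dot.
Local Open Scope ring_scope.
Variables (R : realType) (n : nat).
Implicit Types (c d x y : 'rV[R]_n) (a : R).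

Lemma dotDr c x y : dot c (x + y) = dot c x + dot c y.
Proof. by rewrite /dot -big_split; apply: eq_bigr => i _; rewrite mxE mulrDr. Qed.

Lemma dotZr c a x : dot c (a *: x) = a * dot c x.
Proof. by rewrite /dot mulr_sumr; apply: eq_bigr => i _; rewrite mxE mulrCA. Qed.

Lemma dotBr c x y : dot c (x - y) = dot c x - dot c y.
Proof. by rewrite -scaleN1r dotDr dotZr mulN1r. Qed.

Lemma dot_sumr c (I : finType) (F : I -> 'rV[R]_n) :
  dot c (\sum_i F i) = \sum_i dot c (F i).
Proof.
apply: (big_morph (dot c)); first exact: dotDr.
by rewrite /dot big1 // => i _; rewrite mxE mulr0.
Qed.

Lemma dot_suml (I : finType) (P : pred I) (F : I -> 'rV[R]_n) x :
  dot (\sum_(i | P i) F i) x = \sum_(i | P i) dot (F i) x.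
Proof.
apply: (big_morph (fun c => dot c x)) => [c d|].
  by rewrite /dot -big_split; apply: eq_bigr => i _; rewrite mxE mulrDl.
by rewrite /dot big1 // => i _; rewrite mxE mul0r.
Qed.

Lemma dotZl c a x : dot (a *: c) x = a * dot c x.
Proof. by rewrite /dot mulr_sumr; apply: eq_bigr => i _; rewrite mxE mulrA. Qed.

End Dot.

(** * Cells and faces of an arrangement of integral hyperplanes *)

Section Arrangement.
Local Open Scope classical_set_scope.
Local Open Scope ring_scope.
Variables (R : realType) (n : nat) (I : finType) (c : I -> 'rV[R]_n).
Implicit Types (x y z w : 'rV[R]_n) (i : I).

(* The smallest closed cell containing [x] of the arrangement of all
   hyperplanes on which some [dot (c i)] takes an integer value. *)
Definition cell x : set 'rV[R]_n :=
  [set y | forall i, (Num.floor (dot (c i) x))%:~R <= dot (c i) y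
                       <= (Num.ceil (dot (c i) x))%:~R].

Lemma cell_refl x : cell x x.
Proof. by move=> i; rewrite floor_le ceil_ge. Qed.

Lemma cell_trans x y z : cell x y -> cell y z -> cell x z.
Proof.
move=> xy yz i; have /andP[a1 a2] := xy i; have /andP[b1 b2] := yz i.
apply/andP; split.
  by apply: le_trans b1; rewrite ler_int floor_ge_int.
by apply: le_trans b2 _; rewrite ler_int ceil_le_int.
Qed.

Lemma cell_int x y i : dot (c i) x \is a Num.int -> cell x y ->
  dot (c i) y = dot (c i) x.
Proof.
move=> xi /(_ i); rewrite (floorK xi) (ceilK xi) => h.
by apply/eqP; rewrite eq_le andbC.
Qed.

Lemma floor_lt_nint (t : R) : t \isn't a Num.int -> (Num.floor t)%:~R < t.
Proof.
move=> ti; rewrite lt_neqAle floor_le andbT; apply: contraNneq ti => <-.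
exact: intr_int.
Qed.

Lemma ceil_gt_nint (t : R) : t \isn't a Num.int -> t < (Num.ceil t)%:~R.
Proof.
move=> ti; rewrite lt_neqAle ceil_ge andbT; apply: contraNneq ti => ->.
exact: intr_int.
Qed.

Lemma ceil_le_floor1 (t : R) : ((Num.ceil t)%:~R : R) <= (Num.floor t)%:~R + 1.
Proof.
rewrite -[1]/(1%:~R) -intrD ler_int ceil_floor lerD2l.
by case: (_ \isn't a _).
Qed.

Lemma same_unit_interval (s t : R) : t \isn't a Num.int ->
  (Num.floor t)%:~R < s < (Num.ceil t)%:~R ->
  [/\ s \isn't a Num.int, Num.floor s = Num.floor t & Num.ceil s = Num.ceil t].
Proof.
move=> ti; have e : (Num.ceil t)%:~R = (Num.floor t)%:~R + 1 :> R.
  by rewrite ceil_floor ti intrD.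
rewrite e => /andP[h1 h2].
have f : Num.floor s = Num.floor t.
  by apply: floor_def; rewrite intrD (ltW h1).
have ns : s \isn't a Num.int.
  by apply/negP => si; have := floorK si; rewrite f => h; rewrite h ltxx in h1.
by split=> //; rewrite !ceil_floor f ns ti.
Qed.

Lemma cell_convex x y z t : cell x y -> cell x z -> 0 <= t <= 1 ->
  cell x ((1 - t) *: y + t *: z).
Proof.
move=> hy hz t01 i; have := hy i; have := hz i; rewrite dotDr !dotZr.
set a := _%:~R; set b := _%:~R; move=> /andP[h1 h2] /andP[h3 h4].
by apply/andP; split; nra.
Qed.

(** No integer lies strictly inside the range of a form on the cell, so the cell is on one side of
    each hyperplane with value [e i]. With the matching signs, the sum of these forms is maximal
    exactly where all equalities hold. *)
Lemma tight_face x (J : pred I) (e : I -> R) :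
  (forall i, J i -> e i \is a Num.int) ->
  [set y | cell x y /\ forall i, J i -> dot (c i) y = e i] !=set0 ->
  face (cell x) [set y | cell x y /\ forall i, J i -> dot (c i) y = e i].
Proof.
move=> ei [p [xp pe]]; right.
pose s i : R := if dot (c i) x <= e i then 1 else -1.
have sle y i : J i -> cell x y -> 0 <= s i * (e i - dot (c i) y).
  move=> /ei Ji /(_ i) /andP[h1 h2]; rewrite /s.
  have ie : e i = (Num.floor (e i))%:~R by rewrite floorK.
  case: (leP (dot (c i) x) (e i)) => h.
    by rewrite mul1r subr_ge0 (le_trans h2) // ie ler_int ceil_le_int -ie.
  rewrite mulN1r opprB subr_ge0 (le_trans _ h1) // ie ler_int floor_ge_int -ie.
  exact: ltW.
pose C := \sum_(i | J i) s i *: c i.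
have dC y : dot C y = \sum_(i | J i) s i * e i
    - \sum_(i | J i) s i * (e i - dot (c i) y).
  rewrite /C dot_suml -sumrB; apply: eq_bigr => i _; rewrite dotZl; ring.
have sum0 y : (forall i, J i -> dot (c i) y = e i) ->
    \sum_(i | J i) s i * (e i - dot (c i) y) = 0.
  by move=> h; apply: big1 => i Ji; rewrite h // subrr mulr0.
exists C; apply/seteqP; split=> y /=.
  move=> [xy ye]; split=> // z xz; rewrite !dC (sum0 y) // subr0 lerBlDr lerDl.
  by apply: sumr_ge0 => i Ji; apply: sle.
move=> [xy ymax]; split=> // i Ji; have := ymax p xp; rewrite !dC (sum0 p) // subr0.
rewrite lerBrDr gerDl => le0.
have sum_eq0 : \sum_(i | J i) s i * (e i - dot (c i) y) = 0.
  by apply/eqP; rewrite eq_le le0 sumr_ge0 // => j Jj; apply: sle.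
have /eqP := psumr_eq0P (fun j Jj => sle y j Jj xy) sum_eq0 Ji.
rewrite mulf_eq0 subr_eq0 => /orP[|/eqP //].
by rewrite /s; case: ifP; rewrite ?oppr_eq0 oner_eq0.
Qed.

(** Where the intervals of [x] and [x'] for a form differ, they meet in one integer, the larger
    floor. The intersection is thus the cell of [x] with these forms held at integers. *)
Lemma cell_inter_face x x' : face (cell x) (cell x `&` cell x').
Proof.
have [[p [xp x'p]]|ne] := pselect (cell x `&` cell x' !=set0); last first.
  by left; apply/seteqP; split=> // y hy; case: ne; exists y.
pose J i := ~~ ((Num.floor (dot (c i) x) == Num.floor (dot (c i) x')) &&
                (Num.ceil (dot (c i) x) == Num.ceil (dot (c i) x'))).
have key y i : cell x y -> cell x' y -> J i ->
    dot (c i) y = (Num.max (Num.floor (dot (c i) x)) (Num.floor (dot (c i) x')))%:~R.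
  move=> /(_ i) + /(_ i) +; rewrite /J.
  have := ceil_le_floor1 (dot (c i) x); have := ceil_le_floor1 (dot (c i) x').
  rewrite -[1]/(1%:~R) -!intrD !ler_int.
  set f := Num.floor (dot (c i) x); set g := Num.ceil (dot (c i) x).
  set f' := Num.floor (dot (c i) x'); set g' := Num.ceil (dot (c i) x').
  move=> gf' gf /andP[h1 h2] /andP[h3 h4] ne.
  have fg' : f <= g' by rewrite -(ler_int R); apply: le_trans h1 h4.
  have fg : f <= g by rewrite -(ler_int R); apply: le_trans h1 h2.
  have f'g : f' <= g by rewrite -(ler_int R); apply: le_trans h3 h2.
  have f'g' : f' <= g' by rewrite -(ler_int R); apply: le_trans h3 h4.
  have [e|e] : g = Num.max f f' \/ g' = Num.max f f'.
    by rewrite maxElt; case: ifP; lia.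
  - apply/eqP; rewrite eq_le -{1}e h2 maxElt; by case: ifP.
  - apply/eqP; rewrite eq_le -{1}e h4 maxElt; by case: ifP.
have -> : cell x `&` cell x' =
    [set y | cell x y /\ forall i, J i -> dot (c i) y = dot (c i) p].
  apply/seteqP; split=> y /= [xy].
    by move=> x'y; split=> // i Ji; rewrite (key y) // (key p).
  move=> yp; split=> // i; case: (boolP (J i)) => Ji; first by rewrite yp.
  by move: Ji; rewrite negbK => /andP[/eqP <- /eqP <-].
apply: tight_face; last by exists p.
by move=> i Ji; rewrite (key p) // intr_int.
Qed.

(** A form integral at [x] is constant on the cell, and every other form has room on both sides. *)
Lemma cell_extend x y : cell x y ->
  exists2 t, 0 < t & cell x (x + t *: (x - y)).
Proof.
move=> xy; have [i|d d0 hd] := @small_all R I (fun i t =>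
    (Num.floor (dot (c i) x))%:~R <= dot (c i) x + t * (dot (c i) x - dot (c i) y)
      <= (Num.ceil (dot (c i) x))%:~R).
  case: (boolP (dot (c i) x \is a Num.int)) => xi.
    exists 1 => // t _; rewrite (cell_int xi xy) subrr mulr0 addr0.
    by rewrite floor_le ceil_ge.
  set u := dot (c i) x - _.
  have a1 : 0 < dot (c i) x - (Num.floor (dot (c i) x))%:~R.
    by rewrite subr_gt0 floor_lt_nint.
  have a2 : 0 < (Num.ceil (dot (c i) x))%:~R - dot (c i) x.
    by rewrite subr_gt0 ceil_gt_nint.
  have [d1 d10 h1] := small_pos u a1; have [d2 d20 h2] := small_pos (- u) a2.
  exists (Num.min d1 d2); first by rewrite lt_min d10.
  move=> t /andP[t0]; rewrite le_min => /andP[t1 t2].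
  have := h1 t; have := h2 t; rewrite t0 t1 t2 mulrN => /(_ isT) ? /(_ isT) ?.
  by apply/andP; split; lra.
exists d => // i; rewrite dotDr dotZr dotBr; apply: hd.
by rewrite d0 lexx.
Qed.

(** A point [y] of the face with the fewest integral forms is relatively interior to it. By
    minimality, the midpoint of [y] and any [z] in [F] has the same integral forms as [y], so these
    are constant on [F]. Conversely, a segment from a point of the cell of [y] can be prolonged past
    [y], so that point attains the maximum as well. *)
Lemma face_cell x F : face (cell x) F -> F !=set0 -> exists2 y, F y & F = cell y.
Proof.
case=> [-> []//|[C eF]] Fne.
pose ints y := #|[set i | dot (c i) y \is a Num.int]%SET|.
have ex : exists k, `[< exists2 y, F y & ints y = k >].
  by have [y Fy] := Fne; exists (ints y); apply/asboolP; exists y.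
have [_ /asboolP[y Fy <-] ymin] := ex_minnP ex.
have Fx z : F z -> cell x z by rewrite eF => -[].
have Fmax z w : F z -> cell x w -> dot C w <= dot C z by rewrite eF => -[_]; apply.
exists y => //; apply/seteqP; split=> z.
  move=> Fz; pose w := (1 - 2^-1) *: y + 2^-1 *: z.
  have Fw : F w.
    have xw : cell x w by apply: cell_convex; [exact: Fx|exact: Fx|lra].
    rewrite eF; split=> // u xu; have h1 := Fmax _ _ Fy xu; have h2 := Fmax _ _ Fz xu.
    by rewrite /w dotDr !dotZr; lra.
  have dw i : dot (c i) w = (dot (c i) y + dot (c i) z) / 2.
    by rewrite /w dotDr !dotZr; field.
  have nint i : dot (c i) y \isn't a Num.int ->
     [/\ dot (c i) w \isn't a Num.int,
         Num.floor (dot (c i) y) = Num.floor (dot (c i) x)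
       & Num.ceil (dot (c i) y) = Num.ceil (dot (c i) x)].
    move=> yi; have hy := Fx _ Fy i; have hz := Fx _ Fz i.
    have xi : dot (c i) x \isn't a Num.int.
      by apply: contra yi => xi; rewrite (cell_int xi (Fx _ Fy)).
    have y1 : (Num.floor (dot (c i) x))%:~R < dot (c i) y < (Num.ceil (dot (c i) x))%:~R.
      rewrite !lt_neqAle; have /andP[-> ->] := hy; rewrite !andbT.
      apply/andP; split; first by apply: contraNneq yi => <-; apply: intr_int.
      by apply: contraNneq yi => ->; apply: intr_int.
    have [_ -> ->] := same_unit_interval xi y1; split=> //.
    by have [] := @same_unit_interval (dot (c i) w) _ xi; rewrite // dw; lra.
  have sub : [set i | dot (c i) w \is a Num.int]%SET
      \subset [set i | dot (c i) y \is a Num.int]%SET.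
    apply/fintype.subsetP => i; rewrite !inE; apply: contraLR => /nint[].
    by [].
  have eqI : [set i | dot (c i) w \is a Num.int]%SET
      = [set i | dot (c i) y \is a Num.int]%SET.
    apply/eqP; rewrite eqEcard sub; apply: ymin; apply/asboolP; by exists w.
  move=> i; case: (boolP (dot (c i) y \is a Num.int)) => yi; last first.
    by have [_ -> ->] := nint i yi; apply: Fx.
  have wi : dot (c i) w \is a Num.int.
    by move: (congr1 (fun A : {set I} => i \in A) eqI); rewrite !inE yi.
  suff -> : dot (c i) z = dot (c i) y by rewrite floor_le ceil_ge.
  have hy := Fx _ Fy i; have hz := Fx _ Fz i.
  have cf := ceil_le_floor1 (dot (c i) x).
  have wy : dot (c i) w = dot (c i) y.
    by apply: int_near_eq => //; rewrite dw ltr_norml; lra.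
  by move: wy; rewrite dw; lra.
move=> yz; have [t t0 ht] := cell_extend yz.
have xz := cell_trans (Fx _ Fy) yz; have xt := cell_trans (Fx _ Fy) ht.
have := Fmax _ _ Fy xt; rewrite dotDr dotZr dotBr gerDl pmulr_rle0 // subr_le0 => le.
rewrite eF; split=> // u xu; apply: le_trans le; exact: Fmax.
Qed.

(** After a small move, a form not integral at [x] is still in its unit interval, and one integral
    at [x] is either unchanged or off its integer by less than 1. For generic [z] this puts [x] into
    a generic cell. *)
Lemma cell_perturb x z : exists2 t, 0 < t <= 1 &
  let w := (1 - t) *: x + t *: z in cell w x /\
  forall i, dot (c i) z \isn't a Num.int -> dot (c i) w \isn't a Num.int.
Proof.
pose w t := (1 - t) *: x + t *: z.
have dw i t : dot (c i) (w t) = dot (c i) x + t * (dot (c i) z - dot (c i) x).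
  by rewrite /w dotDr !dotZr; ring.
have [i|d d0 hd] := @small_all R I (fun i t =>
   (Num.floor (dot (c i) (w t)))%:~R <= dot (c i) x <= (Num.ceil (dot (c i) (w t)))%:~R
   /\ (dot (c i) z \isn't a Num.int -> dot (c i) (w t) \isn't a Num.int)).
  set u := dot (c i) z - dot (c i) x.
  case: (boolP (dot (c i) x \is a Num.int)) => xi.
    have [d1 d10 h1] := small_pos u ltr01; have [d2 d20 h2] := small_pos (- u) ltr01.
    exists (Num.min d1 d2); first by rewrite lt_min d10.
    move=> t /andP[t0]; rewrite le_min => /andP[t1 t2].
    have := h1 t; have := h2 t; rewrite t0 t1 t2 mulrN => /(_ isT) g2 /(_ isT) g1.
    have ex : dot (c i) x = (Num.floor (dot (c i) x))%:~R by rewrite floorK.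
    split.
      have fw := floor_le (dot (c i) (w t)); have cw := ceil_ge (dot (c i) (w t)).
      apply/andP; split; rewrite ex ler_int.
        rewrite -ltzD1 floor_lt_int intrD -ex dw -/u; lra.
      have : Num.floor (dot (c i) x) - 1 < Num.ceil (dot (c i) (w t)).
        by rewrite ceil_gt_int intrB -ex dw -/u; lra.
      by rewrite -[X in _ -> X <= _](subrK 1) lezD1.
    move=> zi; apply/negP => wi; have := int_near_eq wi xi.
    rewrite dw -/u addrAC subrr add0r ltr_norml => /(_ _) e.
    have tu0 : t * u = 0.
      have : dot (c i) x + t * u = dot (c i) x by apply: e; apply/andP; split; lra.
      by lra.
    move/eqP: tu0; rewrite mulf_eq0 gt_eqF //= subr_eq0 => /eqP zx.
    by rewrite zx xi in zi.
  have a1 : 0 < dot (c i) x - (Num.floor (dot (c i) x))%:~R.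
    by rewrite subr_gt0 floor_lt_nint.
  have a2 : 0 < (Num.ceil (dot (c i) x))%:~R - dot (c i) x.
    by rewrite subr_gt0 ceil_gt_nint.
  have [d1 d10 h1] := small_pos u a1; have [d2 d20 h2] := small_pos (- u) a2.
  exists (Num.min d1 d2); first by rewrite lt_min d10.
  move=> t /andP[t0]; rewrite le_min => /andP[t1 t2].
  have := h1 t; have := h2 t; rewrite t0 t1 t2 mulrN => /(_ isT) ? /(_ isT) ?.
  have [|wi -> ->] := @same_unit_interval (dot (c i) (w t)) _ xi.
    by rewrite dw -/u; apply/andP; split; lra.
  by rewrite floor_le ceil_ge.
exists (Num.min d 1); first by rewrite lt_min d0 ltr01 ge_min lexx orbT.
have hm : 0 < Num.min d 1 <= d by rewrite lt_min d0 ltr01 ge_min lexx.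
by split=> i; have [] := hd _ hm i.
Qed.

(* Writing [y] as a convex combination of an integral point [b] of its cell and
   of the point where the ray from [b] through [y] leaves that cell. *)
Lemma cell_integral_hull (H : set 'rV[R]_n) x :
  (forall a b t, H a -> H b -> 0 <= t <= 1 -> H ((1 - t) *: a + t *: b)) ->
  (forall y z, (forall i, dot (c i) y = dot (c i) z) -> y = z) ->
  (forall y, cell x y -> exists b,
     [/\ H b, cell y b & forall i, dot (c i) b \is a Num.int]) ->
  cell x `<=` H.
Proof.
move=> Hconv sep vert y.
move: {2}#|_| (leqnn #|[set i | dot (c i) y \isn't a Num.int]%SET|) => m.
elim: m y => [|m IH] y hm xy; have [b [Hb yb bint]] := vert y xy.
  suff -> : y = b by [].
  apply: sep => i; apply/esym/cell_int => //; apply/negPn/negP => yi.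
  by move: hm; rewrite leqn0 cards_eq0 => /eqP/setP/(_ i); rewrite !inE yi.
have [e|[i0 i0n]] := set_0Vmem [set i | dot (c i) y \isn't a Num.int]%SET.
  by apply: IH => //; rewrite e cards0.
pose g i := `|dot (c i) y - dot (c i) b|.
have [i iP imax] := @arg_maxP _ _ _ i0 predT g isT.
have yi0 : dot (c i0) y \isn't a Num.int by rewrite inE in i0n.
have gpos : 0 < g i.
  apply: lt_le_trans (imax i0 isT); rewrite normr_gt0 subr_eq0.
  by apply: contraNneq yi0 => ->.
have gint j : dot (c j) y \is a Num.int -> dot (c j) b = dot (c j) y.
  by move=> yj; rewrite (cell_int yj yb).
have bnear j : dot (c j) y \isn't a Num.int ->
    (dot (c j) b = (Num.floor (dot (c j) y))%:~R \/
     dot (c j) b = (Num.ceil (dot (c j) y))%:~R) /\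
    (Num.ceil (dot (c j) y))%:~R = (Num.floor (dot (c j) y))%:~R + 1 :> R.
  move=> yj.
  have e : (Num.ceil (dot (c j) y))%:~R = (Num.floor (dot (c j) y))%:~R + 1 :> R.
    by rewrite ceil_floor yj intrD.
  split=> //; have /andP[h1 h2] := yb j; rewrite e in h2 *.
  by apply: int_step => //; rewrite ?intr_int //; lra.
have glt1 j : g j < 1.
  rewrite /g; case: (boolP (dot (c j) y \is a Num.int)) => yj.
    by rewrite gint // subrr normr0.
  have := floor_lt_nint yj; have := ceil_gt_nint yj.
  by have [[->|->] ?] := bnear j yj; rewrite ltr_norml; lra.
(* Each form not integral at [y] has at [b] an end of its unit interval; along the ray, the form [i]
   of largest deviation is the first to reach the other end. *)
pose y' := b + (g i)^-1 *: (y - b).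
have dy' j : dot (c j) y' = dot (c j) b + (dot (c j) y - dot (c j) b) / g i.
  by rewrite dotDr dotZr dotBr mulrC.
have yE : y = (1 - g i) *: b + g i *: y'.
  rewrite /y' scalerDr scalerA mulfV ?gt_eqF // scale1r scalerBl scale1r.
  by rewrite addrA subrK addrC subrK.
have cy' : cell y y'.
  move=> j; rewrite dy'; case: (boolP (dot (c j) y \is a Num.int)) => yj.
    by rewrite gint // subrr mul0r addr0 floor_le ceil_ge.
  have gj : g j / g i <= 1 by rewrite ler_pdivrMr // mul1r; apply: imax.
  have gj0 : 0 <= g j / g i by apply: divr_ge0; [exact: normr_ge0 | exact: ltW].
  have := floor_lt_nint yj; have := ceil_gt_nint yj; move: gj gj0.
  rewrite -[g j]/(`|dot (c j) y - dot (c j) b|).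
  have [[e|e] e'] := bnear j yj; rewrite e => gj gj0 c1 c2.
    rewrite ger0_norm in gj gj0; last by rewrite subr_ge0 ltW.
    by rewrite e'; lra.
  rewrite ler0_norm in gj gj0; last by rewrite subr_le0 ltW.
  rewrite mulNr in gj gj0; rewrite e'; rewrite e' in gj gj0; lra.
rewrite yE; apply: Hconv => //; last by rewrite ltW //= ltW.
apply: IH; last exact: cell_trans cy'.
rewrite -ltnS; apply: leq_trans hm; apply: proper_card; apply/properP; split.
  apply/fintype.subsetP => j; rewrite !inE; apply: contra => yj.
  by rewrite (cell_int yj cy').
exists i; rewrite !inE.
  apply: contraTN gpos => yj; by rewrite /g gint // subrr normr0 ltxx.
(* At [y'] the form [i] differs by exactly 1 from its integer at [b], so one more form has become
   integral. *)
rewrite negbK dy'; have : `|(dot (c i) y - dot (c i) b) / g i| = 1.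
  by rewrite normrM normfV (gtr0_norm gpos) divff // gt_eqF.
move/eqP; rewrite eqr_norml ler01 andbT => /orP[]/eqP ->; rewrite rpredD ?rpredN //;
  exact: rpred1.
Qed.

End Arrangement.

(** * The region and the step rules in terms of counts *)

Section Region.
Variables (n : nat) (U : {set 'I_n}).
Implicit Types (P B : {set 'I_n}) (k a b : nat).

Lemma cnt_mono B j k : j <= k -> cnt B j <= cnt B k.
Proof.
move=> /subnKC <-; elim: (k - j) => [|d IH]; first by rewrite addn0.
by rewrite addnS; have := cntS_bounds B (j + d); lia.
Qed.

Lemma cnt_lip B j k : j <= k -> cnt B k <= cnt B j + (k - j).
Proof.
move=> /subnKC <-; rewrite addKn; elim: (k - j) => [|d IH]; first by rewrite !addn0.
by rewrite !addnS; have := cntS_bounds B (j + d); lia.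
Qed.

Lemma cnt_le_card B k : cnt B k <= #|B|.
Proof. by apply: subset_leq_card; apply/subsetP => i; rewrite inE => /andP[]. Qed.

Lemma cntC B k : k <= n -> cnt B k + cnt (~: B) k = k.
Proof.
elim: k => [|k IH] kn; first by rewrite !cnt0.
rewrite !(cntS _ (Ordinal kn)) inE; have := IH (ltnW kn).
by rewrite /=; case: (_ \in B) => /=; lia.
Qed.

Lemma cardU_le : #|U| <= n.
Proof. by rewrite -[X in _ <= X]card_ord max_card. Qed.

Lemma path_pointE P k : path_point P k = (cnt (~: P) k, cnt P k).
Proof. by congr pair; apply: eq_card => i; rewrite !inE andbC. Qed.

Lemma cnt_card : cnt U n = #|U|.
Proof. exact: cnt_ge. Qed.

(** The comparison with path(U) moves from the column [a] to the antidiagonal [a + b]. The top of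
    path(U) in the column is its last vertex with at most [a] east steps. *)
Lemma in_regionE a b : in_region U (a, b) =
  [&& a <= n - #|U|, b <= #|U| & b <= cnt U (a + b)].
Proof.
have rn := cardU_le; have eC := cntC U (leqnn n); rewrite cnt_ge // in eC.
have nr : n - #|U| = cnt (~: U) n by rewrite -[X in X - _]eC addKn.
apply/andP/and3P => [[/existsP[k] /andP[]]|[an br bc]].
  rewrite path_pointE /= => /eqP ka bk _.
  have kn : k <= n by rewrite -ltnS.
  have kC := cntC U kn; split; last 2 first.
  - exact: leq_trans bk (cnt_le_card _ _).
  - have abk : a + b <= k by lia.
    by have := cnt_lip U abk; lia.
  - by rewrite nr -ka cnt_mono.
split.
  have abn : a + b <= n by lia.
  have ex : exists k, (k <= n) && (cnt (~: U) k <= a).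
    by exists (a + b); rewrite abn; have := cntC U abn; lia.
  have bd k : (k <= n) && (cnt (~: U) k <= a) -> k <= n by case/andP.
  case: (ex_maxnP ex bd) => k /andP[kn ka] kmax.
  have abk : a + b <= k.
    by apply: kmax; rewrite abn; have := cntC U abn; lia.
  apply/existsP; exists (inord k); rewrite path_pointE /= inordK ?ltnS //.
  apply/andP; split; last by apply: leq_trans bc (cnt_mono _ abk).
  rewrite eqn_leq ka /=; case: (eqVneq k n) => [->|kn']; first by rewrite -nr.
  have kn1 : k < n by lia.
  rewrite leqNgt; apply/negP => lt.
  have bd1 := cntS_bounds (~: U) k; have : k.+1 <= k by apply: kmax; lia.
  by rewrite ltnn.
(* The lower path starts with n - r east steps and so meets the column [a] at height 0. *)
have an' : a <= n by lia.
apply/existsP; exists (inord a); rewrite path_pointE /= inordK ?ltnS //.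
have c0 : cnt (lower_set U) a = 0.
  apply: eq_card0 => i; rewrite !inE; apply/negP => /andP[h1 h2].
  by have := leq_trans (leq_trans h2 an) h1; rewrite ltnn.
by have := cntC (lower_set U) an'; rewrite c0 add0n => ->; rewrite eqxx.
Qed.

Lemma vertical_stepE a b : vertical_step U (a, b) =
  (cnt U (a + b) == b) && (b < cnt U (a + b).+1).
Proof.
apply/exists_inP/andP => [[i iU]|[/eqP e lt]].
  rewrite path_pointE => /eqP[ca cb]; have := cntC U (ltnW (ltn_ord i)).
  rewrite ca cb addnC => ->; rewrite cb eqxx cntS iU cb; split=> //; lia.
have abn : a + b < n.
  rewrite ltnNge; apply/negP => nab; move: lt; rewrite -{1}e !cnt_ge ?ltnn //.
  exact: leqW.
exists (Ordinal abn).
  by move: lt; rewrite (cntS U (Ordinal abn)) /= e; case: (_ \in U) => //; lia.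
rewrite path_pointE /= e; have := cntC U (ltnW abn); rewrite e => h.
by apply/eqP; congr pair; lia.
Qed.

(** If [b] equals the count at [a + b], the point is on path(U), and a north end inside the region
    would make the segment a step of path(U). Excluding this leaves the strict inequality. *)
Lemma north_allowedE a b :
  north_allowed U (a, b) = (a <= n - #|U|) && (b < cnt U (a + b)).
Proof.
rewrite /north_allowed /= in_regionE vertical_stepE addnS.
have := cntS_bounds U (a + b); have := cnt_le_card U (a + b).
case: (a <= n - #|U|) => //=.
by case: (ltngtP b (cnt U (a + b))) => /=; lia.
Qed.

Lemma step_allowed_East a b : step_allowed U (a, b) East =
  [&& a < n - cnt U n, b <= cnt U n & b <= cnt U (a + b).+1].
Proof. by rewrite cnt_card /step_allowed /= in_regionE addSn andbT. Qed.

Lemma step_allowed_North a b : step_allowed U (a, b) North =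
  (a <= n - cnt U n) && (b < cnt U (a + b)).
Proof.
rewrite cnt_card /step_allowed north_allowedE /= in_regionE addnS.
have := cntS_bounds U (a + b); have := cnt_le_card U (a + b).
case: (a <= n - _) => //=; case: (ltnP b (cnt U (a + b))) => /=; last by rewrite andbF.
by move=> h1 h2 /andP[h3 _]; rewrite (leq_trans h1 h2) (leq_trans h1 h3).
Qed.

Lemma step_allowed_Diagonal a b : step_allowed U (a, b) Diagonal =
  (a < n - cnt U n) && (b < cnt U (a + b)).
Proof.
rewrite cnt_card /step_allowed north_allowedE /= in_regionE addnS addSn.
have := cntS_bounds U (a + b); have := cntS_bounds U (a + b).+1.
have := cnt_le_card U (a + b).
case: (ltnP a (n - _)) => //= an; rewrite (ltnW an) /=.
case: (ltnP b (cnt U (a + b))) => /=; last by rewrite andbF.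
move=> h1 h2 /andP[h3 _] /andP[h4 _].
by rewrite (leq_trans h1 h2) (leq_trans h1 (leq_trans h4 h3)).
Qed.

Lemma schubert_basesE B : (B \in bases (schubert U)) =
  (#|B| == #|U|) && [forall k : 'I_n.+1, cnt B k <= cnt U k].
Proof.
rewrite inE; case: eqP => //= e; apply/gale_leP/forallP => [[_ h] k|h]; first exact: h.
split=> // k; case: (ltnP k n.+1) => kn; first exact: (h (Ordinal kn)).
by have := h ord_max; rewrite -/(cnt B k) -/(cnt U k) !(cnt_ge _ (ltnW kn)) !cnt_ge.
Qed.

(** A basis through the first element forces path(U) to start with a north step. *)
Lemma loopless_cnt k : 0 < n -> loopless (schubert U) -> 0 < k -> 0 < cnt U k.
Proof.
move=> n0 ll k0; apply: leq_trans (cnt_mono U k0).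
have := ll (Ordinal n0); rewrite /loop inE /= negb_forall => /existsP[B].
rewrite negb_imply negbK => /andP[]; rewrite (schubert_basesE B).
case/andP => _ /forallP/(_ (inord 1)); rewrite inordK // => h oB.
by apply: leq_trans h; rewrite (cntS B (Ordinal n0)) oB addn1.
Qed.

(** A basis avoiding the last element forces path(U) to end with an east step, so after [k] steps
    fewer than [n - k] north steps remain. *)
Lemma coloopless_cnt k : coloopless (schubert U) -> k < n ->
  cnt U n + k < cnt U k + n.
Proof.
move=> cl kn; have n0 : n.-1 < n by lia.
have := cl (Ordinal n0); rewrite /coloop inE /= negb_forall => /existsP[B].
rewrite negb_imply => /andP[]; rewrite (schubert_basesE B).
case/andP => /eqP cB /forallP/(_ (inord n.-1)); rewrite inordK; last lia.
move=> h oB; have cBn : cnt B n = cnt U n by rewrite !cnt_ge.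
have := cntS B (Ordinal n0); rewrite (negPf oB) /= prednK; last lia.
have kn1 : k <= n.-1 by lia.
have h2 := cnt_lip U kn1; rewrite cBn => h4.
lia.
Qed.

End Region.

(** * Delannoy paths and sequences of prefix sums *)

Section DelannoySequences.
Local Open Scope ring_scope.
Variables (R : realType) (n : nat) (U : {set 'I_n}).
Implicit Types (s : nat -> R) (p : nat * nat) (w : seq step).

Definition strict_seq s :=
  [/\ s 0%N = 0, s n = (cnt U n)%:R,
      forall k, (k < n)%N -> s k < s k.+1 < s k + 1
    & forall k, (0 < k < n)%N -> s k < (cnt U k)%:R].

(* A vertex [(a, b)] of the path stands for the unit interval [(b - 1, b)]
   containing [s (a + b - 1)]; a diagonal step from it for [s (a + b) = b]. *)
Fixpoint conforms s p w : Prop :=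
  p.2%:R - 1 < s (p.1 + p.2).-1 < p.2%:R /\
  if w is a :: w' then
    (is_diagonal a -> s (p.1 + p.2)%N = p.2%:R) /\ conforms s (step_end p a) w'
  else True.

Lemma conforms_head s p w : conforms s p w ->
  p.2%:R - 1 < s (p.1 + p.2).-1 < p.2%:R.
Proof. by case: w => [|? ?] []. Qed.

Lemma conforms_ext s s' p w : (forall k, ((p.1 + p.2).-1 <= k)%N -> s k = s' k) ->
  conforms s p w -> conforms s' p w.
Proof.
elim: w p => [|c w IH] [a b] /= e.
  by rewrite -e.
rewrite -e // -(e (a + b)%N) ?leq_pred // => -[h [h1 h2]]; split=> //; split=> //.
by apply: IH h2 => k hk; apply: e; apply: leq_trans hk; case: c {h1} => /=; lia.
Qed.

Definition updated s m t k : R := if k == m then t else s k.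

Definition strict_from m s := s n = (cnt U n)%:R /\ forall k, (m <= k < n)%N ->
  s k < s k.+1 < s k + 1 /\ s k < (cnt U k)%:R.

Lemma strict_from_updated m s t : strict_from m.+1 s -> (m < n)%N ->
  t < s m.+1 < t + 1 -> t < (cnt U m)%:R -> strict_from m (updated s m t).
Proof.
move=> [sn sk] mn ts tc; rewrite /strict_from /updated; split.
  by rewrite gtn_eqF.
move=> k /andP[mk kn]; rewrite (gtn_eqF (_ : (m < k.+1)%N)) ?ltnS //.
by have [->|km] := eqVneq k m; [|apply: sk; lia].
Qed.

(** The sequence is built backwards from its end value r. The bound on [b] keeps the whole unit
    interval of the vertex below the count of [U]. *)
Lemma conforms_strict_exists a b w : (0 < a)%N -> (0 < b)%N ->
  (b <= cnt U (a + b).-1)%N -> admissible_from U (a, b) w ->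
  exists2 s, strict_from (a + b).-1 s & conforms s (a, b) w.
Proof.
elim: w a b => [|c w IH] a b a0 b0 bc /=.
  rewrite -cnt_card xpair_eqE => /andP[/eqP ea /eqP eb].
  have rn : (cnt U n <= n)%N by rewrite cnt_card cardU_le.
  have abn : (a + b = n)%N by lia.
  have n1 : (n.-1 < n)%N by lia.
  have n1n : (n.-1 == n) = false by lia.
  exists (fun k => if k == n then (cnt U n)%:R else (cnt U n)%:R - 1 / 2).
    split; first by rewrite eqxx.
    move=> k kn; have -> : k = n.-1 by lia.
    rewrite prednK ?eqxx; last lia.
    have : (b%:R : R) <= (cnt U (a + b).-1)%:R by rewrite ler_nat.
    by rewrite n1n abn eb; split; lra.
  by rewrite abn n1n eb; split=> //; lra.
have [m em] : exists m, (a + b)%N = m.+1 by exists (a + b).-1; lia.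
rewrite em /= in bc *; have bcR : (b%:R : R) <= (cnt U m)%:R by rewrite ler_nat.
case/andP; case: c => [||] /=.
- rewrite step_allowed_East em => /and3P[an br _] /IH[//|//||s sf cs].
    by rewrite addSn em /=; have := cntS_bounds U m; lia.
  rewrite addSn em /= in sf; have mn : (m < n)%N by lia.
  have := conforms_head cs; rewrite /= ?addSn ?em => /= c1.
  (* Midway between b - 1 and the next value; the same choice works for a north step, where the next
     value is between b and b + 1. *)
  exists (updated s m ((b%:R - 1 + s m.+1) / 2)).
    by apply: strict_from_updated => //; lra.
  split; first by rewrite /updated eqxx; lra.
  split=> //; apply: conforms_ext cs => k /=; rewrite ?addSn ?em /= /updated => mk.
  by rewrite gtn_eqF.
- rewrite step_allowed_North em => /andP[an bu] /IH[//|//||s sf cs].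
    by rewrite addnS em.
  rewrite addnS em /= in sf.
  have mn : (m < n)%N by have := cnt_le_card U m.+1; rewrite -cnt_card; lia.
  have := conforms_head cs; rewrite /= ?addnS /= ?em -natr1 => /= c1.
  exists (updated s m ((b%:R - 1 + s m.+1) / 2)).
    by apply: strict_from_updated => //; lra.
  split; first by rewrite /updated eqxx; lra.
  split=> //; apply: conforms_ext cs => k /=; rewrite ?addnS ?em /= ?em /updated => mk.
  by rewrite gtn_eqF.
rewrite step_allowed_Diagonal em => /andP[an bu] /IH[//|//||s sf cs].
  by rewrite addnS addSn em /=; have := cntS_bounds U m.+1; lia.
rewrite addnS addSn em /= in sf.
have mn : (m.+1 < n)%N by have := cnt_le_card U m.+1; rewrite -cnt_card; lia.
have := conforms_head cs; rewrite /= ?addnS ?addSn /= ?em -natr1 => /= c1.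
have buR : (b%:R + 1 : R) <= (cnt U m.+1)%:R by rewrite natr1 ler_nat.
have sf' : strict_from m.+1 (updated s m.+1 b%:R).
  by apply: strict_from_updated => //; lra.
(* A diagonal step sets two values: the integer [b], and before it the middle of the unit interval
   below [b]. *)
exists (updated (updated s m.+1 b%:R) m (b%:R - 1 / 2)).
  by apply: strict_from_updated => //; rewrite ?(ltnW mn) // ?/updated ?eqxx; lra.
split; first by rewrite /updated eqxx; lra.
split; first by move=> _; rewrite /updated gtn_eqF // eqxx.
apply: conforms_ext cs => k /=; rewrite ?addnS ?addSn ?em /= ?em /updated => mk.
by rewrite !gtn_eqF //; lia.
Qed.

Lemma strict_seq_lip s j k : strict_seq s -> (j <= k <= n)%N ->
  s j <= s k <= s j + (k - j)%:R.
Proof.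
case=> _ _ h _ /andP[/subnKC <-]; rewrite addKn.
elim: (k - j)%N => [|d IH] dn; first by rewrite addn0 addr0 lexx.
have := IH (leq_trans (leq_addr _ _) _); rewrite addnS in dn.
move=> /(_ 1%N); rewrite addn1 => /(_ dn) {}IH.
by have := h (j + d)%N dn; rewrite addnS -natr1; lra.
Qed.

(** The step is read off by comparing the value at [a + b] with [b]. The bound on [a] comes from the
    end: the sequence climbs by at most one per index and still has to reach r. *)
Lemma strict_seq_conforms s a b : strict_seq s -> (0 < a)%N -> (0 < b)%N ->
  (a + b <= n)%N -> b%:R - 1 < s (a + b).-1 < b%:R ->
  exists2 w, admissible_from U (a, b) w & conforms s (a, b) w.
Proof.
move=> ss; have [s0 sn stp sc] := ss.
have rn : (cnt U n <= n)%N by rewrite cnt_card cardU_le.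
move: {2}(n - (a + b))%N (leqnn (n - (a + b))) => d.
elim: d a b => [|d IH] a b hd a0 b0 abn hs.
all: have [m em] : exists m, (a + b)%N = m.+1 by exists (a + b).-1; lia.
all: have := stp m; rewrite -em => /(_ abn) st; rewrite em /= in hs.
all: have [e|abn'] := eqVneq (a + b)%N n.
(* The integer r lies strictly between b - 1 and b + 1. *)
1,3: have eb : b = cnt U n.
1,3: apply/eqP; rewrite eqn_leq -ltnS -[X in _ && X]ltnS -!(ltr_nat R) -!natr1;
     rewrite e sn in st; apply/andP; split; lra.
1,2: exists [::] => /=; [rewrite -cnt_card xpair_eqE; lia | by rewrite em].
- by exfalso; lia.
have mn : (m.+1 < n)%N by lia.
have br : (b <= cnt U n)%N.
  rewrite -ltnS -(ltr_nat R) -natr1 -sn.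
  have mn' : (m <= n <= n)%N by rewrite leqnn (ltnW (ltnW mn)).
  by have := strict_seq_lip ss mn'; lra.
have lipn : (cnt U n)%:R <= s m.+1 + (n - m.+1)%:R.
  have mn' : (m.+1 <= n <= n)%N by rewrite leqnn (ltnW mn).
  by have := strict_seq_lip ss mn'; rewrite sn; lra.
have scm := sc m.+1 (_ : (0 < m.+1 < n)%N); rewrite mn /= in scm; have {}scm := scm isT.
rewrite em in st.
have [lt|gt|eq] := ltrgtP (s m.+1) b%:R.
- have an : (a < n - cnt U n)%N.
    suff : (cnt U n < b + (n - m.+1))%N by lia.
    by rewrite -(ltr_nat R) natrD; lra.
  have bc : (b <= cnt U m.+1)%N.
    by rewrite -ltnS -(ltr_nat R) -natr1; lra.
  have p1 : (n - (a.+1 + b) <= d)%N by lia.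
  have p4 : (a.+1 + b <= n)%N by lia.
  have p5 : b%:R - 1 < s (a.+1 + b).-1 < b%:R by rewrite addSn em; apply/andP; split; lra.
  have [w hw cw] := IH _ _ p1 isT b0 p4 p5.
  exists (East :: w) => /=; last by rewrite em /=; split=> //; lra.
  rewrite step_allowed_East hw andbT an br em.
  by apply: leq_trans bc (cnt_mono _ _).
- have bc : (b < cnt U m.+1)%N by rewrite -(ltr_nat R); lra.
  have an : (a <= n - cnt U n)%N.
    have lipm : (cnt U n)%:R <= s m + (n - m)%:R.
      have mn' : (m <= n <= n)%N by rewrite leqnn (ltnW (ltnW mn)).
      by have := strict_seq_lip ss mn'; rewrite sn; lra.
    suff : (cnt U n < b + (n - m))%N by lia.
    by rewrite -(ltr_nat R) natrD; lra.
  have p1 : (n - (a + b.+1) <= d)%N by lia.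
  have p4 : (a + b.+1 <= n)%N by lia.
  have p5 : b.+1%:R - 1 < s (a + b.+1).-1 < b.+1%:R.
    by rewrite addnS em -natr1; apply/andP; split; lra.
  have [w hw cw] := IH _ _ p1 a0 isT p4 p5.
  exists (North :: w) => /=; last by rewrite em /=; split=> //; lra.
  by rewrite step_allowed_North hw andbT an em.
have bc : (b < cnt U m.+1)%N by rewrite -(ltr_nat R); lra.
have st2 := stp m.+1 mn.
(* Otherwise the integer r would lie strictly between b and b + 1. *)
have m2n : (m.+2 < n)%N.
  rewrite ltn_neqAle mn andbT; apply/eqP => e2; rewrite e2 sn eq in st2.
  have : (b < cnt U n)%N by rewrite -(ltr_nat R); lra.
  have : (cnt U n < b.+1)%N by rewrite -(ltr_nat R) -natr1; lra.
  by lia.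
have an : (a < n - cnt U n)%N.
  have lip2 : (cnt U n)%:R <= s m.+2 + (n - m.+2)%:R.
    have mn' : (m.+2 <= n <= n)%N by rewrite leqnn (ltnW m2n).
    by have := strict_seq_lip ss mn'; rewrite sn; lra.
  suff : (cnt U n < b + 1 + (n - m.+2))%N by lia.
  by rewrite -(ltr_nat R) !natrD; lra.
have p1 : (n - (a.+1 + b.+1) <= d)%N by lia.
have p4 : (a.+1 + b.+1 <= n)%N by lia.
have p5 : b.+1%:R - 1 < s (a.+1 + b.+1).-1 < b.+1%:R.
  by rewrite addnS addSn em -natr1; apply/andP; split; lra.
have [w hw cw] := IH _ _ p1 isT isT p4 p5.
exists (Diagonal :: w) => /=; last by rewrite em /=; split=> //; lra.
by rewrite step_allowed_Diagonal hw andbT an em.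
Qed.

End DelannoySequences.

(** * A path and the rounding of a sequence determine each other *)

Section ConformsUnique.
Local Open Scope ring_scope.
Variables (R : realType) (n : nat) (U : {set 'I_n}).
Implicit Types (s : nat -> R) (p : nat * nat) (w : seq step).

Lemma admissible_step_lt a b c w : admissible_from U (a, b) (c :: w) ->
  (a + b < n)%N.
Proof.
have h : (cnt U (a + b) <= cnt U n)%N by rewrite cnt_card cnt_le_card.
have rn : (cnt U n <= n)%N by rewrite cnt_card cardU_le.
move=> /= /andP[+ _]; case: c => [||].
- by rewrite step_allowed_East => /and3P[h1 h2 _]; lia.
- by rewrite step_allowed_North => /andP[h1 h2]; lia.
- by rewrite step_allowed_Diagonal => /andP[h1 h2]; lia.
Qed.

Lemma admissible_nil a b : admissible_from U (a, b) [::] -> (a + b)%N = n.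
Proof.
have := cardU_le U; rewrite /= -cnt_card xpair_eqE => h /andP[/eqP-> /eqP->].
by rewrite subnK.
Qed.

Lemma conforms_next s a b c w : conforms s (a, b) (c :: w) ->
  match c with
  | East => s (a + b)%N < b%:R
  | North => b%:R < s (a + b)%N
  | Diagonal => s (a + b)%N == b%:R
  end.
Proof.
case: c => /= -[_ [h /conforms_head]] /=; first by case/andP.
  by rewrite addnS -natr1 /=; lra.
by rewrite h.
Qed.

Lemma conforms_unique s a b w w' :
  admissible_from U (a, b) w -> admissible_from U (a, b) w' ->
  conforms s (a, b) w -> conforms s (a, b) w' -> w = w'.
Proof.
elim: w w' a b => [|c w IH] [|c' w'] a b //.
- by move=> /admissible_nil e /admissible_step_lt; rewrite e ltnn.
- by move=> /admissible_step_lt h /admissible_nil e; rewrite e ltnn in h.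
move=> /= /andP[_ aw] /andP[_ aw'] cw cw'.
have ec : c = c'; last rewrite ec in aw cw *.
  have := conforms_next cw; have := conforms_next cw'.
  by case: (ltrgtP (s (a + b)%N) b%:R); case: (c); case: (c').
congr (_ :: _); case: cw => _ [_ cw]; case: cw' => _ [_ cw'].
by move: aw aw' cw cw'; case: (step_end (a, b) c') => a' b'; apply: IH.
Qed.

Lemma open_unitE (b : nat) (t : R) : (b%:R - 1 < t < b%:R) =
  (Num.floor t == b%:Z - 1) && (Num.ceil t == b%:Z).
Proof.
rewrite floor_eq ceil_eq subrK intrB -pmulrn.
apply/idP/idP => [/andP[h1 h2]|/andP[/andP[h1 h2] /andP[h3 h4]]].
  by rewrite h1 h2 !ltW.
by rewrite h2 h3.
Qed.

Lemma nat_roundE (b : nat) (t : R) : (t == b%:R) =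
  (Num.floor t == b%:Z) && (Num.ceil t == b%:Z).
Proof.
rewrite floor_eq ceil_eq intrB intrD -pmulrn.
apply/eqP/andP => [->|[/andP[h1 h2] /andP[h3 h4]]]; last lra.
by rewrite lexx; split; lra.
Qed.

Lemma open_unit_nint (b : nat) (t : R) : b%:R - 1 < t < b%:R -> t \isn't a Num.int.
Proof.
rewrite open_unitE => /andP[/eqP e1 /eqP e2]; apply/negP => ti.
by have := floorK ti; have := ceilK ti; rewrite e1 e2 intrB -pmulrn; lra.
Qed.

(** Same open unit interval or same integer: all that a cell remembers of a form. *)
Definition same_round (t t' : R) :=
  Num.floor t = Num.floor t' /\ Num.ceil t = Num.ceil t'.

Lemma conforms_same_round s s' p w : (forall k, (k < n)%N -> same_round (s k) (s' k)) ->
  (p.1 + p.2 <= n)%N -> (0 < p.1 + p.2)%N -> admissible_from U p w ->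
  conforms s p w -> conforms s' p w.
Proof.
move=> h; have op k (b : nat) : (k < n)%N ->
    (b%:R - 1 < s k < b%:R) = (b%:R - 1 < s' k < b%:R).
  by move=> /h[e1 e2]; rewrite !open_unitE e1 e2.
elim: w p => [|c w IH] [a b] /= abn ab0 aw.
  by rewrite op //; lia.
have ab := admissible_step_lt (w := w) aw; case/andP: aw => _ aw.
case=> h1 [h2 h3]; split; first by rewrite -op //; lia.
split.
  move=> /h2 e; apply/eqP; have := h _ ab => -[e1 e2].
  by rewrite nat_roundE -e1 -e2 -nat_roundE e.
apply: IH h3 => //; last by case: c {h2 aw} => /=; lia.
case: w aw => [|c' w]; last by case: (step_end _ _) => a' b' /admissible_step_lt /ltnW.
by case: (step_end _ _) => a' b' /admissible_nil ->.
Qed.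

Lemma same_round_conforms s s' a b w :
  (0 < a + b)%N -> admissible_from U (a, b) w ->
  conforms s (a, b) w -> conforms s' (a, b) w ->
  forall k, ((a + b).-1 <= k < n)%N -> same_round (s k) (s' k).
Proof.
have op (c : nat) (t t' : R) :
    c%:R - 1 < t < c%:R -> c%:R - 1 < t' < c%:R -> same_round t t'.
  rewrite !open_unitE => /andP[/eqP e1 /eqP e2] /andP[/eqP e3 /eqP e4].
  by rewrite /same_round e1 e2 e3 e4.
elim: w a b => [|c w IH] a b ab0 aw cw cw' k /andP[k1 k2].
  have := admissible_nil aw => abn; have -> : k = (a + b).-1 by lia.
  exact: op (conforms_head cw) (conforms_head cw').
have [->|kab] := eqVneq k (a + b).-1.
  exact: op (conforms_head cw) (conforms_head cw').
have {}k1 : (a + b <= k)%N by lia.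
move: aw cw cw' => /= /andP[_ aw] [_ [d1 c1]] [_ [d2 c2]].
case: c d1 d2 aw c1 c2 => /= d1 d2 aw c1 c2.
- by apply: (IH _ _ _ aw c1 c2); lia.
- by apply: (IH _ _ _ aw c1 c2); lia.
have [->|kab'] := eqVneq k (a + b)%N; first by rewrite d1 // d2.
by apply: (IH _ _ _ aw c1 c2); lia.
Qed.

(** Each vertex accounts for one nonintegral value and each diagonal step for one integral value;
    together they exhaust the indices. *)
Lemma diagonals_cuts s a b w : (0 < a)%N -> (0 < b)%N ->
  admissible_from U (a, b) w -> conforms s (a, b) w ->
  diagonals w = (\sum_((a + b).-1 <= k < n) (s k \is a Num.int))%N.
Proof.
elim: w a b => [|c w IH] a b a0 b0 aw cw.
  have abn := admissible_nil aw; have := open_unit_nint (conforms_head cw) => /= ni.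
  by rewrite -abn -{2}(@prednK (a + b)%N) ?big_nat1 ?(negPf ni) //; lia.
have ab := admissible_step_lt aw; have := open_unit_nint (conforms_head cw) => /= ni.
rewrite big_ltn ?(negPf ni) ?add0n ?prednK; try lia.
move: aw cw => /= /andP[_ aw] [_ [d1 c1]].
case: c d1 aw c1 => /= d1 aw c1.
- by rewrite add0n (IH _ _ _ _ aw c1) // addSn.
- by rewrite add0n (IH _ _ _ _ aw c1) // addnS.
rewrite (IH _ _ _ _ aw c1) // addnS addSn /= [RHS]big_ltn // d1 //.
by rewrite natr_int.
Qed.

End ConformsUnique.

(** * Convex hulls of 0/1 vectors *)

Section ConvexHulls.
Local Open Scope classical_set_scope.
Local Open Scope ring_scope.
Variables (R : realType) (n : nat).
Implicit Types (c x y : 'rV[R]_n) (s : seq 'rV[R]_n) (B : {set 'I_n}).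

Lemma dot_hull_le c (m : R) s : (forall y, y \in s -> dot c y <= m) ->
  forall x, convex_hull s x -> dot c x <= m.
Proof.
move=> h x [l [l0 l1 ->]]; rewrite dot_sumr -[m]mul1r -l1 mulr_suml.
by apply: ler_sum => i _; rewrite dotZr ler_wpM2l // h // mem_nth.
Qed.

Lemma dot_hull_ge c (m : R) s : (forall y, y \in s -> m <= dot c y) ->
  forall x, convex_hull s x -> m <= dot c x.
Proof.
move=> h x [l [l0 l1 ->]]; rewrite dot_sumr -[m]mul1r -l1 mulr_suml.
by apply: ler_sum => i _; rewrite dotZr ler_wpM2l // h // mem_nth.
Qed.

Lemma convex_hull_mem s y : y \in s -> convex_hull s y.
Proof.
move=> ys; have i0 : (index y s < size s)%N by rewrite index_mem.
exists (fun i => (i == Ordinal i0)%:R); split.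
- by move=> i; apply: ler0n.
- by rewrite (bigD1 (Ordinal i0)) //= eqxx big1 ?addr0 // => i /negPf ->.
- rewrite (bigD1 (Ordinal i0)) //= eqxx scale1r nth_index // big1 ?addr0 //.
  by move=> i /negPf ->; rewrite scale0r.
Qed.

Lemma convex_hull_convex s x y (t : R) : convex_hull s x -> convex_hull s y ->
  0 <= t <= 1 -> convex_hull s ((1 - t) *: x + t *: y).
Proof.
move=> [l [l0 l1 ->]] [l' [l'0 l'1 ->]] t01.
exists (fun i => (1 - t) * l i + t * l' i); split.
- by move=> i; rewrite addr_ge0 // mulr_ge0 //; lra.
- by rewrite big_split /= -!mulr_sumr l1 l'1; lra.
- rewrite !scaler_sumr -big_split; apply: eq_bigr => i _ /=.
  by rewrite !scalerA -scalerDl.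
Qed.

(** The form that is 1 on [B] and -1 off [B] is smaller by at least 1 at every other 0/1 vector.
    Hence a base polytope determines its bases. *)
Lemma indicator_hull (BB : {set {set 'I_n}}) B :
  convex_hull [seq indicator R C | C <- enum BB] (indicator R B) -> B \in BB.
Proof.
move=> hB; apply/negPn/negP => nB.
pose c : 'rV[R]_n := \row_l (if l \in B then 1 else -1).
suff : dot c (indicator R B) <= dot c (indicator R B) - 1 by lra.
move: hB; apply: dot_hull_le => _ /mapP[C + ->].
rewrite mem_enum => hC; have [l0 ne] : exists l, (l \in B) != (l \in C).
  apply/existsP; apply: contraNT nB; rewrite negb_exists => /forallP h.
  suff -> : B = C by [].
  by apply/setP => l; have := h l; rewrite negbK => /eqP.
rewrite lerBrDr -lerBrDl /dot -sumrB (bigD1 l0) //= !mxE -[leLHS]addr0; apply: lerD.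
  by case: (l0 \in B) ne; case: (l0 \in C) => //=; lra.
by apply: sumr_ge0 => l _; rewrite !mxE; case: (l \in B); case: (l \in C) => /=; lra.
Qed.

End ConvexHulls.

(** * The arrangement of prefix sums and coordinates *)

Section PrefixArrangement.
Local Open Scope classical_set_scope.
Local Open Scope ring_scope.
Variables (R : realType) (n : nat).
Implicit Types (v y : 'rV[R]_n) (B : {set 'I_n}) (N : matroid 'I_n).

Notation psumT v := (psum [set: 'I_n] (v ord0)).

Definition prefix_forms (i : 'I_n.+1 + 'I_n) : 'rV[R]_n :=
  match i with
  | inl k => \row_l (l < k)%N%:R
  | inr l => \row_j (j == l)%:R
  end.

Notation pcell := (cell prefix_forms).

Lemma dot_prefix v k : dot (prefix_forms (inl k)) v = psumT v k.
Proof.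
rewrite /dot /psum [RHS]big_mkcond; apply: eq_bigr => l _; rewrite mxE in_setT /=.
by case: (l < k)%N; rewrite ?mul1r ?mul0r.
Qed.

Lemma dot_coord v l : dot (prefix_forms (inr l)) v = v ord0 l.
Proof.
rewrite /dot (bigD1 l) //= mxE eqxx mul1r big1 ?addr0 // => j /negPf jl.
by rewrite mxE jl mul0r.
Qed.

Lemma near_intE (m t : R) : m \is a Num.int ->
  ((Num.floor t)%:~R <= m <= (Num.ceil t)%:~R) = (`|m - t| < 1).
Proof.
move=> mi; have f1 := floor_itv t; have c1 := ceil_itv t.
rewrite intrD in f1; rewrite intrB in c1.
rewrite ltr_norml; apply/idP/idP => [h|h]; first lra.
by apply/andP; split; apply: int_lt_le; rewrite ?intr_int //; lra.
Qed.

Lemma indicator_int B i : dot (prefix_forms i) (indicator R B) \is a Num.int.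
Proof.
by case: i => [k|l]; rewrite ?dot_prefix ?dot_coord ?mxE ?natr_int // psum_int //
  => l _; rewrite mxE natr_int.
Qed.

Lemma psum_indicator B k : psumT (indicator R B) k = psum [set: 'I_n] (charf R B) k.
Proof. by apply: eq_psum => l _ _; rewrite mxE. Qed.

Lemma pcell_indicator v B : pcell v (indicator R B) <-> wbase [set: 'I_n] (v ord0) B.
Proof.
split=> [h|/wbaseP[_ h1 h2] i].
  apply/and3P; split; first exact: subsetT.
    apply/forallP => k; have := h (inl k); rewrite near_intE ?indicator_int //.
    by rewrite !dot_prefix psum_indicator.
  apply/forall_inP => l _; have := h (inr l); rewrite near_intE ?indicator_int //.
  by rewrite !dot_coord mxE.
rewrite near_intE ?indicator_int //; case: i => [k|l].
  by rewrite !dot_prefix psum_indicator.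
by rewrite !dot_coord mxE; apply: h2; rewrite inE.
Qed.

Lemma pcell_weighting v y : weighting [set: 'I_n] (v ord0) -> pcell v y ->
  weighting [set: 'I_n] (y ord0).
Proof.
move=> [v01 vi] vy; split=> [l _|].
  have := vy (inr l); rewrite !dot_coord => /andP[h1 h2].
  have /andP[v0 v1] := v01 l (in_setT l); apply/andP; split.
    by apply: le_trans h1; rewrite ler0z floor_ge_int.
  by apply: le_trans h2 _; rewrite -[1]/(1%:~R) ler_int ceil_le_int.
have : dot (prefix_forms (inl ord_max)) v \is a Num.int by rewrite dot_prefix.
by move/cell_int => /(_ _ vy); rewrite !dot_prefix => ->.
Qed.

(** Rounding supplies the integral points for [cell_integral_hull]. Any family [BB] containing the
    bases of the cell is allowed, so the lemma serves both the matroid of the cell and the Schubert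
    matroid. *)
Lemma pcell_sub_hull v (BB : {set {set 'I_n}}) : weighting [set: 'I_n] (v ord0) ->
  (forall B, wbase [set: 'I_n] (v ord0) B -> B \in BB) ->
  pcell v `<=` convex_hull [seq indicator R B | B <- enum BB].
Proof.
move=> wv sub; apply: cell_integral_hull.
- exact: convex_hull_convex.
- by move=> y z e; apply/rowP => l; have := e (inr l); rewrite !dot_coord.
move=> y vy; have wy := pcell_weighting wv vy.
have [|B hB _] := @rounding_base R n _ _ 0 wy; first lra.
have yB : pcell y (indicator R B) by apply/pcell_indicator.
exists (indicator R B); split=> //; last exact: indicator_int.
apply: convex_hull_mem; apply: map_f; rewrite mem_enum; apply: sub.
by apply/pcell_indicator; apply: cell_trans yB.
Qed.

Lemma pcell_polytope v N : weighting [set: 'I_n] (v ord0) ->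
  has_weights N [set: 'I_n] (v ord0) -> pcell v = base_polytope R N.
Proof.
move=> wv [_ bN]; apply/seteqP; split.
  by apply: pcell_sub_hull => // B; rewrite bN.
have h y i : y \in [seq indicator R B | B <- enum (bases N)] ->
    (Num.floor (dot (prefix_forms i) v))%:~R <= dot (prefix_forms i) y
      <= (Num.ceil (dot (prefix_forms i) v))%:~R.
  by case/mapP => B; rewrite mem_enum bN => /pcell_indicator + ->; apply.
move=> y hy i; apply/andP; split.
  by apply: dot_hull_ge hy => z /(h _ i) /andP[].
by apply: dot_hull_le hy => z /(h _ i) /andP[].
Qed.

Lemma polytope_weights v N : ground N = [set: 'I_n]%SET ->
  base_polytope R N = pcell v -> has_weights N [set: 'I_n] (v ord0).
Proof.
move=> gN e; split=> // B; apply/idP/idP => hB.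
  apply/pcell_indicator; rewrite -e; apply: convex_hull_mem; apply: map_f.
  by rewrite mem_enum.
by apply: (@indicator_hull R); rewrite -/(base_polytope R N) e; apply/pcell_indicator.
Qed.

Lemma pcell_same_round v y : pcell v = pcell y -> forall i,
  same_round (dot (prefix_forms i) v) (dot (prefix_forms i) y).
Proof.
move=> e i; have := cell_refl prefix_forms v; have := cell_refl prefix_forms y.
rewrite -{1}e => /(_ i) h1; rewrite e => /(_ i) h2; split; apply/eqP; rewrite eq_le.
  by rewrite !floor_ge_int; case/andP: h1 => -> _; case/andP: h2 => ->.
by rewrite !ceil_le_int; case/andP: h1 => _ ->; case/andP: h2 => _ ->.
Qed.

Lemma same_round_pcell v y :
  (forall i, same_round (dot (prefix_forms i) v) (dot (prefix_forms i) y)) ->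
  pcell v = pcell y.
Proof.
by move=> h; apply/seteqP; split=> z hz i; have := hz i; have [-> ->] := h i.
Qed.

Lemma same_round_int (t t' : R) : same_round t t' ->
  (t \is a Num.int) = (t' \is a Num.int).
Proof.
case=> e1 e2; have := ceil_floor t; have := ceil_floor t'; rewrite e1 e2 => ->.
by move/addrI; do 2 case: (_ \is a Num.int).
Qed.

End PrefixArrangement.

(** * The subdivision of the Schubert polytope and its bijection with paths *)

Section SchubertSubdivision.
Local Open Scope classical_set_scope.
Local Open Scope ring_scope.
Variables (R : realType) (n : nat) (U : {set 'I_n}).
Hypotheses (n_gt0 : (0 < n)%N) (ll : loopless (schubert U)).
Hypothesis cl : coloopless (schubert U).
Implicit Types (v y z : 'rV[R]_n) (B : {set 'I_n}) (N : matroid 'I_n).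
Implicit Types (Q : set 'rV[R]_n) (w : seq step).

Notation psumT v := (psum [set: 'I_n] (v ord0)).
Notation forms := (@prefix_forms R n).
Notation pcell := (cell forms).

Definition schubert_ineqs : set 'rV[R]_n := [set v |
  [/\ forall l, 0 <= v ord0 l <= 1, forall k, psumT v k <= (cnt U k)%:R
    & psumT v n = (cnt U n)%:R]].

Lemma ineqs_weighting v : schubert_ineqs v -> weighting [set: 'I_n] (v ord0).
Proof. by case=> h _ e; split=> // ; rewrite e natr_int. Qed.

(** All bounds are integers, so the cell of a point cannot cross them. *)
Lemma ineqs_pcell v y : schubert_ineqs v -> pcell v y -> schubert_ineqs y.
Proof.
move=> hv vy; have wv := ineqs_weighting hv; have [_ h2 h3] := hv.
have [w1 _] := pcell_weighting wv vy.
have hk k : (k <= n)%N -> psumT y k <= (cnt U k)%:R.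
  move=> kn; have /andP[_] := vy (inl (Ordinal (kn : (k < n.+1)%N))).
  rewrite !dot_prefix /= => /le_trans; apply.
  by rewrite (pmulrn _ (cnt U k)) ler_int ceil_le_int -pmulrn h2.
split=> [l|k|]; first by apply: w1; rewrite inE.
  case: (leqP k n) => [/hk //|/ltnW nk].
  by rewrite psum_ge // cnt_ge // -(cnt_ge U (leqnn n)) hk.
have i : dot (forms (inl ord_max)) v \is a Num.int by rewrite dot_prefix h3 natr_int.
by have := cell_int i vy; rewrite !dot_prefix h3.
Qed.

Lemma ineqs_convex v y (t : R) : schubert_ineqs v -> schubert_ineqs y ->
  0 <= t <= 1 -> schubert_ineqs ((1 - t) *: v + t *: y).
Proof.
move=> [a1 a2 a3] [b1 b2 b3] t01.
have e k : psumT ((1 - t) *: v + t *: y) k = (1 - t) * psumT v k + t * psumT y k.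
  by rewrite /psum !mulr_sumr -big_split; apply: eq_bigr => l _; rewrite !mxE.
split=> [l|k|].
- by rewrite !mxE; have := a1 l; have := b1 l; move=> ? ?; apply/andP; split; nra.
- by rewrite e; have := a2 k; have := b2 k; move=> ? ?; nra.
- by rewrite e a3 b3; lra.
Qed.

Lemma schubert_base_ineqs B :
  (B \in bases (schubert U)) <-> schubert_ineqs (indicator R B).
Proof.
rewrite schubert_basesE; split.
  case/andP => /eqP cB /forallP h; split=> [l|k|].
  - by rewrite mxE; case: (l \in B) => /=; lra.
  - rewrite psum_indicator psum_charf ?subsetT // ler_nat.
    case: (ltnP k n.+1) => kn; first exact: (h (Ordinal kn)).
    by rewrite !(cnt_ge _ (ltnW kn)) cB.
  - by rewrite psum_indicator psum_charf ?subsetT // !cnt_ge // cB.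
case=> _ h2; rewrite psum_indicator psum_charf ?subsetT // => /eqP.
rewrite eqr_nat !cnt_ge // => -> /=; apply/forallP => k.
by have := h2 k; rewrite psum_indicator psum_charf ?subsetT // ler_nat.
Qed.

(** For the harder inclusion, a point lies in its own cell, and the 0/1 points of that cell satisfy
    the same inequalities, hence are bases. *)
Lemma schubert_polytope : base_polytope R (schubert U) = schubert_ineqs.
Proof.
apply/seteqP; split=> [v hv|v hv].
  have bd y : y \in [seq indicator R B | B <- enum (bases (schubert U))] ->
      schubert_ineqs y.
    by case/mapP => B; rewrite mem_enum => /schubert_base_ineqs + ->.
  have hk k : (k <= n)%N -> psumT v k <= (cnt U k)%:R.
    move=> kn; have := @dot_hull_le R n (forms (inl (Ordinal (kn : (k < n.+1)%N)))).
    move=> /(_ (cnt U k)%:R _ _ _ hv); rewrite dot_prefix; apply.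
    by move=> y /bd[_ h _]; rewrite dot_prefix; apply: h.
  split=> [l|k|].
  - rewrite -dot_coord; apply/andP; split.
      by apply: dot_hull_ge hv => y /bd[h _ _]; rewrite dot_coord; case/andP: (h l).
    by apply: dot_hull_le hv => y /bd[h _ _]; rewrite dot_coord; case/andP: (h l).
  - case: (leqP k n) => [/hk //|/ltnW nk].
    by rewrite psum_ge // cnt_ge // -(cnt_ge U (leqnn n)) hk.
  - apply/eqP; rewrite eq_le hk //=.
    have := @dot_hull_ge R n (forms (inl ord_max)).
    move=> /(_ (cnt U n)%:R _ _ _ hv); rewrite dot_prefix; apply.
    by move=> y /bd[_ _ h]; rewrite dot_prefix /= h.
have wv := ineqs_weighting hv; apply: (pcell_sub_hull wv) (cell_refl _ _) => B hB.
by apply/schubert_base_ineqs; apply: ineqs_pcell hv _; apply/pcell_indicator.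
Qed.

Definition strict v := schubert_ineqs v /\ strict_seq U (psumT v).

Lemma strictP v : schubert_ineqs v ->
  (forall l, 0 < v ord0 l < 1) ->
  (forall k, (0 < k < n)%N -> psumT v k < (cnt U k)%:R) -> strict v.
Proof.
move=> hv v01 vk; split=> //; have [_ _ e] := hv; split=> //; first exact: psum0.
move=> k kn; rewrite (psumS _ _ (Ordinal kn)) in_setT.
by have := v01 (Ordinal kn) => /= h; lra.
Qed.

Lemma strict_coord v l : strict v -> 0 < v ord0 l < 1.
Proof.
case=> _ [_ _ h _]; have := h l (ltn_ord l); rewrite psumS in_setT; lra.
Qed.

Lemma strict_seq_row (s : nat -> R) : strict_seq U s ->
  exists2 v, strict v & forall k, (k <= n)%N -> psumT v k = s k.
Proof.
move=> [s0 sn stp sc]; pose v : 'rV[R]_n := \row_(l < n) (s l.+1 - s l).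
have e k : (k <= n)%N -> psumT v k = s k.
  elim: k => [|k IH] kn; first by rewrite psum0 s0.
  by rewrite (psumS _ _ (Ordinal kn)) in_setT mxE /= IH ?(ltnW kn) //; lra.
have v01 l : 0 < v ord0 l < 1 by rewrite mxE; have := stp l (ltn_ord l); lra.
exists v => //; apply: strictP => //; last first.
  by move=> k kn; rewrite e; [apply: sc | case/andP: kn => _ /ltnW].
split=> [l|k|]; first by have := v01 l; lra.
  wlog kn : k / (k <= n)%N.
    move=> H; case: (leqP k n) => [/H //|/ltnW nk].
    by rewrite psum_ge // cnt_ge // -(cnt_ge U (leqnn n)) H.
  rewrite e //; case: (posnP k) => [->|k0]; first by rewrite s0 ler0n.
  have [->|kn'] := eqVneq k n; first by rewrite sn.
  by apply/ltW/sc; rewrite k0 ltn_neqAle kn' kn.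
by rewrite e.
Qed.

Lemma cardU_bounds : (0 < cnt U n)%N /\ (cnt U n < n)%N.
Proof.
split; first exact: (loopless_cnt n_gt0 ll n_gt0).
have n1 : (n.-1 < n)%N by lia.
have := coloopless_cnt cl n1; have := cnt_lip U (leq0n n.-1); rewrite cnt0; lia.
Qed.

Lemma region11 : in_region U (1, 1)%N.
Proof.
have [h1 h2] := cardU_bounds; rewrite in_regionE -cnt_card h1 (loopless_cnt n_gt0 ll) //.
by rewrite subn_gt0 h2.
Qed.

Lemma delannoy_strict w : admissible_delannoy U w ->
  exists2 v, strict v & conforms (psumT v) (1, 1)%N w.
Proof.
case/andP => _ aw; have [//|//|||s sf cs] := @conforms_strict_exists R n U 1 1 w.
- exact: loopless_cnt n_gt0 ll _.
- exact: aw.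
have h1 := conforms_head cs; rewrite /= subrr in h1.
have n2 : (1 < n)%N by have [r0 rn] := cardU_bounds; lia.
(* A path from (1,1) determines nothing before index 1, so the value 0 is put in at index 0. *)
have sf0 : strict_seq U (updated s 0 0).
  case: sf => sn sk; rewrite /updated; split=> //.
  - by rewrite gtn_eqF.
  - move=> [|k] kn /=; first lra.
    by have [] := sk k.+1 kn.
  - by move=> [|k] // /andP[_ kn]; have [] := sk k.+1 kn.
have [v sv ev] := strict_seq_row sf0; exists v => //.
have same k : (k < n)%N -> same_round (updated s 0 0 k) (psumT v k).
  by move=> kn; rewrite ev // ltnW.
apply: (conforms_same_round same) aw _ => //.
by apply: conforms_ext cs => -[|k].
Qed.

Lemma strict_delannoy v : strict v ->
  exists2 w, admissible_delannoy U w & conforms (psumT v) (1, 1)%N w.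
Proof.
case=> _ sv; have [s0 _ stp _] := sv; have := stp 0%N n_gt0; rewrite s0 => h1.
have n2 : (1 < n)%N by have [r0 rn] := cardU_bounds; lia.
have [|w aw cw] := @strict_seq_conforms R n U _ 1 1 sv isT isT n2.
- by rewrite /= subrr; lra.
by exists w => //; rewrite /admissible_delannoy region11.
Qed.

Lemma admissible_north b d : (cnt U n = b + d)%N ->
  admissible_from U (n - cnt U n, b)%N (nseq d North).
Proof.
elim: d b => [|d IH] b e /=; first by rewrite -cnt_card e addn0.
have [_ rn] := cardU_bounds.
rewrite IH ?addSnnS // andbT step_allowed_North leqnn /=.
have kn : (n - cnt U n + b < n)%N by lia.
by have := coloopless_cnt cl kn; lia.
Qed.

Lemma admissible_east a d : (0 < a)%N -> (n - cnt U n = a + d)%N ->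
  admissible_from U (a, 1)%N (nseq d East ++ nseq (cnt U n).-1 North).
Proof.
have [r0 rn] := cardU_bounds.
elim: d a => [|d IH] a a0 e /=.
  have -> : a = (n - cnt U n)%N by lia.
  by apply: admissible_north; lia.
rewrite IH ?addSnnS // andbT step_allowed_East r0 (loopless_cnt n_gt0 ll) // andbT; lia.
Qed.

(** The point comes from a path without diagonal steps: along the bottom row to the last column,
    then straight up. *)
Lemma exists_generic : exists2 z, strict z &
  forall k, (0 < k < n)%N -> psumT z k \isn't a Num.int.
Proof.
have [r0 rn] := cardU_bounds.
pose w := nseq (n - cnt U n).-1 East ++ nseq (cnt U n).-1 North.
have aw : admissible_from U (1, 1)%N w by apply: admissible_east; lia.
have [|z sz cz] := @delannoy_strict w; first by rewrite /admissible_delannoy region11.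
exists z => // k /andP[k0 kn]; have := diagonals_cuts (ltn0Sn 0) (ltn0Sn 0) aw cz.
rewrite /diagonals /w count_cat !count_nseq /= => /esym/eqP.
rewrite sum_nat_seq_eq0 => /allP/(_ k); rewrite mem_index_iota k0 kn => /(_ isT).
by case: (_ \is a _).
Qed.

Lemma strict_extend v y : strict v -> schubert_ineqs y ->
  exists2 t, 0 < t & schubert_ineqs (v + t *: (v - y)).
Proof.
move=> sv; have [[_ v2 v3] [_ _ _ vk]] := sv; move=> [y1 y2 y3].
have e k t : psumT (v + t *: (v - y)) k = psumT v k + t * (psumT v k - psumT y k).
  rewrite /psum -sumrB mulr_sumr -big_split; apply: eq_bigr => l _.
  by rewrite !mxE.
have [k|d1 d10 h1] := @small_all R 'I_n.+1 (fun k t =>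
    psumT (v + t *: (v - y)) k <= (cnt U k)%:R).
  have [k0|k0] := posnP k.
    by exists 1 => // t _; rewrite k0 !psum0 ler0n.
  have [kn|kn] := eqVneq (k : nat) n.
    by exists 1 => // t _; rewrite kn e v3 y3 subrr mulr0 addr0.
  have a0 : 0 < (cnt U k)%:R - psumT v k.
    by rewrite subr_gt0; apply: vk; rewrite k0 ltn_neqAle kn -ltnS ltn_ord.
  have [d d0 hd] := small_pos (psumT y k - psumT v k) a0.
  by exists d => // t /hd; rewrite e; lra.
have [l|d2 d20 h2] := @small_all R 'I_n (fun l t =>
    0 <= (v + t *: (v - y)) ord0 l <= 1).
  have /andP[a0 a1] := strict_coord l sv; rewrite -subr_gt0 in a1.
  have [d d0 hd] := small_pos (v ord0 l - y ord0 l) a0.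
  have [d' d'0 hd'] := small_pos (y ord0 l - v ord0 l) a1.
  exists (Num.min d d'); first by rewrite lt_min d0.
  move=> t /andP[t0]; rewrite le_min => /andP[td td'].
  have := hd t; have := hd' t; rewrite t0 td td' !mxE => /(_ isT) ? /(_ isT) ?.
  by apply/andP; split; lra.
exists (Num.min d1 d2); first by rewrite lt_min d10.
have m1 : 0 < Num.min d1 d2 <= d1 by rewrite lt_min d10 d20 ge_min lexx.
have m2 : 0 < Num.min d1 d2 <= d2 by rewrite lt_min d10 d20 ge_min lexx orbT.
split; [exact: h2 | | by rewrite e v3 y3 subrr mulr0 addr0].
move=> k; case: (ltnP k n.+1) => kn; first exact: (h1 _ m1 (Ordinal kn)).
by rewrite psum_ge ?(ltnW kn) // cnt_ge ?(ltnW kn) // -cnt_card; apply: (h1 _ m1 ord_max).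
Qed.

(** Every segment ending at [v] can be prolonged past it, so a form that is maximal at [v] is
    constant on the polytope. *)
Lemma strict_not_boundary v : strict v -> ~ (boundary schubert_ineqs) v.
Proof.
move=> sv [F [fF FP Fv]]; apply: FP; case: fF => [F0|[c eF]].
  by rewrite F0 in Fv.
have cmax y : schubert_ineqs y -> dot c y <= dot c v.
  by move=> Py; move: Fv; rewrite eF => -[_]; apply.
rewrite eF; apply/seteqP; split=> y; first by case.
move=> Py; split=> // y' Py'; apply: le_trans (cmax _ Py') _.
have [t t0 ht] := strict_extend sv Py.
by have := cmax _ ht; rewrite dotDr dotZr dotBr gerDl pmulr_rle0 // subr_le0.
Qed.

Lemma tight_boundary v c (m : R) :
  (forall y, schubert_ineqs y -> dot c y <= m) ->
  (forall y, pcell v y -> dot c y = m) ->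
  (exists2 z, schubert_ineqs z & dot c z < m) -> schubert_ineqs v ->
  pcell v `<=` boundary schubert_ineqs.
Proof.
move=> le eqm [z Pz lt] Pv y vy.
exists [set x | schubert_ineqs x /\ forall x', schubert_ineqs x' -> dot c x' <= dot c x].
split; first by right; exists c.
- move=> e; have [_ /(_ v Pv)] : [set x | schubert_ineqs x /\
     forall x', schubert_ineqs x' -> dot c x' <= dot c x] z by rewrite e.
  by rewrite (eqm v (cell_refl _ _)); lra.
- split; first exact: ineqs_pcell vy.
  by move=> x' /le; rewrite (eqm y vy).
Qed.

(** A bound attained at [v] is an integer, so it is attained on the whole cell, while a strict point
    shows that it is not attained on the whole polytope. *)
Lemma internal_strict v : schubert_ineqs v ->
  ~ (pcell v `<=` boundary schubert_ineqs) -> strict v.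
Proof.
move=> Pv nb; have [z sz _] := exists_generic; have [Pz [_ _ _ zk]] := sz.
have [v1 v2 v3] := Pv; apply: strictP => // [l|k kn].
  have z01 := strict_coord l sz; have := v1 l => /andP[]; rewrite !le_eqVlt.
  case/orP => [/eqP v0|-> /orP[/eqP v0|-> //]]; exfalso; apply: nb.
    apply: (@tight_boundary v (-1 *: forms (inr l)) 0) => //.
    - by move=> y [h _ _]; rewrite dotZl dot_coord; have := h l; lra.
    - move=> y vy; have i : dot (forms (inr l)) v \is a Num.int.
        by rewrite dot_coord -v0 rpred0.
      by rewrite dotZl (cell_int i vy) dot_coord -v0 mulr0.
    - by exists z; rewrite // dotZl dot_coord; lra.
  apply: (@tight_boundary v (forms (inr l)) 1) => //.
  - by move=> y [h _ _]; rewrite dot_coord; have := h l; lra.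
  - move=> y vy; have i : dot (forms (inr l)) v \is a Num.int.
      by rewrite dot_coord v0 rpred1.
    by rewrite (cell_int i vy) dot_coord.
  - by exists z; rewrite // dot_coord; lra.
rewrite lt_neqAle v2 andbT; apply/eqP => e; apply: nb.
have kn1 : (k < n.+1)%N by lia.
apply: (@tight_boundary v (forms (inl (Ordinal kn1))) (cnt U k)%:R) => //.
- by move=> y [_ h _]; rewrite dot_prefix; apply: h.
- move=> y vy; have i : dot (forms (inl (Ordinal kn1))) v \is a Num.int.
    by rewrite dot_prefix /= e natr_int.
  by rewrite (cell_int i vy) dot_prefix.
- by exists z; rewrite // dot_prefix; apply: zk.
Qed.

Definition subdivision : set (set 'rV[R]_n) :=
  [set Q | exists2 v, schubert_ineqs v & Q = pcell v].

Lemma cell_matroid v : schubert_ineqs v -> exists2 N,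
  has_weights N [set: 'I_n] (v ord0) & pcell v = base_polytope R N.
Proof.
move=> /ineqs_weighting wv; have [N hN] := weights_matroid wv.
by exists N => //; apply: pcell_polytope.
Qed.

Lemma subdivision_matroid : matroid_subdivision schubert_ineqs subdivision.
Proof.
split; last first.
  move=> _ [v Pv ->]; have [N [gN _] e] := cell_matroid Pv.
  by exists N; rewrite gN.
split.
(* A cell is the hull of the indicators of some family of sets, and there are finitely many
   families. *)
- apply: (@sub_finite_set _ _ [set convex_hull [seq indicator R B | B <- enum BB]
      | BB in [set: {set {set 'I_n}}]]).
    by move=> _ [v Pv ->]; have [N _ ->] := cell_matroid Pv; exists (bases N).
  exact/finite_image/finite_finset.
- move=> _ [v Pv ->]; split; last by exists v; apply: cell_refl.
  have [N _ ->] := cell_matroid Pv.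
  by exists [seq indicator R B | B <- enum (bases N)].
- apply/seteqP; split=> [y [_ [v Pv ->]]|v Pv]; first exact: ineqs_pcell.
  by exists (pcell v); [exists v | apply: cell_refl].
- move=> _ F [v Pv ->] fF Fne; have [y Fy e] := face_cell fF Fne.
  exists y => //; apply: ineqs_pcell Pv _.
  case: fF => [F0|[c eF]]; first by rewrite F0 in Fy.
  by move: Fy; rewrite eF => -[].
- move=> _ _ [v Pv ->] [y Py ->]; split; first exact: cell_inter_face.
  by rewrite classical_sets.setIC; apply: cell_inter_face.
Qed.

Definition path_cell Q w := exists v,
  [/\ strict v, Q = pcell v & conforms (psumT v) (1, 1)%N w].

Notation internal := (internal_faces schubert_ineqs subdivision).

Lemma strict_internal v : strict v -> internal (pcell v).
Proof.
move=> sv; split; first by exists v => //; case: sv.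
by move=> /(_ v (cell_refl _ _)); apply: strict_not_boundary.
Qed.

Lemma internal_path Q : internal Q ->
  exists2 w, admissible_delannoy U w & path_cell Q w.
Proof.
case=> -[v Pv ->] /(internal_strict Pv) sv; have [w aw cw] := strict_delannoy sv.
by exists w => //; exists v.
Qed.

Lemma pcell_psum_round v y k : pcell v = pcell y -> (k < n)%N ->
  same_round (psumT v k) (psumT y k).
Proof.
move=> e kn; have kn1 : (k < n.+1)%N by lia.
by have := pcell_same_round e (inl (Ordinal kn1)); rewrite !dot_prefix.
Qed.

Lemma path_cell_fun Q w w' : admissible_delannoy U w -> admissible_delannoy U w' ->
  path_cell Q w -> path_cell Q w' -> w = w'.
Proof.
move=> /andP[_ aw] /andP[_ aw'] [v [sv -> cv]] [v' [_ e cv']].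
have [r0 rn] := cardU_bounds.
apply: (conforms_unique aw aw' cv); apply: (conforms_same_round _ _ _ aw' cv') => //.
  by move=> k kn; apply: pcell_psum_round.
by rewrite /=; lia.
Qed.

(** The path fixes the rounding of the inner prefix sums, the outer two are constant on the
    polytope, and all coordinates lie strictly between 0 and 1. *)
Lemma path_cell_inj Q Q' w : admissible_delannoy U w ->
  path_cell Q w -> path_cell Q' w -> Q = Q'.
Proof.
move=> /andP[_ aw] [v [sv -> cv]] [v' [sv' -> cv']]; apply: same_round_pcell.
case=> [k|l].
  rewrite !dot_prefix; have [k0|k0] := posnP k; first by rewrite k0 !psum0.
  have [kn|kn] := eqVneq (k : nat) n.
    by rewrite kn; have [[_ _ ->] _] := sv; have [[_ _ ->] _] := sv'.
  apply: (same_round_conforms _ aw cv cv') => //=.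
  by rewrite k0 ltn_neqAle kn -ltnS ltn_ord.
rewrite !dot_coord; have := strict_coord l sv; have := strict_coord l sv'.
have u (t : R) : (0 < t < 1) = (1%:R - 1 < t < 1%:R) by rewrite subrr.
rewrite !u !open_unitE => /andP[/eqP e1 /eqP e2] /andP[/eqP e3 /eqP e4].
by rewrite /same_round e1 e2 e3 e4.
Qed.

(** Pushing a point of the cell slightly toward a generic point gives a cell containing the old one,
    hence equal to it by maximality. *)
Lemma maximal_generic Q : maximal_cells subdivision Q -> exists v,
  [/\ strict v, Q = pcell v
    & forall k, (0 < k < n)%N -> psumT v k \isn't a Num.int].
Proof.
case=> -[x Px ->] mx; have [z sz zg] := exists_generic.
have [t t01 /= [wx wg]] := cell_perturb forms x z.
set v := _ + _ in wx wg; have [Pz [_ _ _ zk]] := sz; have [x1 x2 _] := Px.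
have Pv : schubert_ineqs v by apply: ineqs_convex => //; lra.
have ev k : psumT v k = (1 - t) * psumT x k + t * psumT z k.
  by rewrite /psum !mulr_sumr -big_split; apply: eq_bigr => l _; rewrite !mxE.
exists v; split.
- apply: strictP => // [l|k kn].
    rewrite !mxE; have := x1 l; have := strict_coord l sz => ? ?.
    by apply/andP; split; nra.
  by rewrite ev; have := zk k kn; have := x2 k => ? ?; nra.
- by apply/esym/mx; [exists v | move=> y; apply: cell_trans].
- move=> k kn; have kn1 : (k < n.+1)%N by lia.
  have := wg (inl (Ordinal kn1)); rewrite !dot_prefix; apply; exact: zg.
Qed.

(** In a cell containing [v], a form not integral at [v] has the same unit interval; the remaining
    forms are constant on the polytope. *)
Lemma generic_maximal v : strict v ->
  (forall k, (0 < k < n)%N -> psumT v k \isn't a Num.int) ->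
  maximal_cells subdivision (pcell v).
Proof.
move=> sv vg; have [Pv _] := sv; split; first by exists v.
move=> _ [y Py ->] /(_ v (cell_refl _ _)) yv; apply: same_round_pcell => i.
have gen : dot (forms i) v \isn't a Num.int \/ dot (forms i) y = dot (forms i) v.
  case: i => [k|l]; rewrite ?dot_prefix ?dot_coord; last first.
    by left; apply: (@open_unit_nint R 1); rewrite subrr strict_coord.
  have [k0|k0] := posnP k; first by right; rewrite k0 !psum0.
  have [kn|kn] := eqVneq (k : nat) n.
    by right; rewrite kn; have [_ _ ->] := Pv; have [_ _ ->] := Py.
  by left; apply: vg; rewrite k0 ltn_neqAle kn -ltnS ltn_ord.
case: gen => [vi|->] //; have /andP[h1 h2] := yv i.
have yi : dot (forms i) y \isn't a Num.int.
  by apply: contra vi => yi; rewrite (cell_int yi yv).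
have [|_ e1 e2] := @same_unit_interval _ (dot (forms i) v) _ yi; last by split.
rewrite !lt_neqAle h1 h2 !andbT; apply/andP; split.
  by apply: contraNneq vi => <-; apply: intr_int.
by apply: contraNneq vi => ->; apply: intr_int.
Qed.

Lemma path_cell_maximal Q w : admissible_delannoy U w -> path_cell Q w ->
  maximal_cells subdivision Q <-> diagonals w = 0%N.
Proof.
move=> /andP[_ aw] [v [sv eQ cv]]; rewrite (diagonals_cuts (ltn0Sn 0) (ltn0Sn 0) aw cv) /=.
split=> [mQ|/eqP].
  have [v' [_ e g]] := maximal_generic mQ.
  rewrite big_nat big1 // => k kn; rewrite eQ in e.
  have kn' : (k < n)%N by case/andP: kn.
  by rewrite (same_round_int (pcell_psum_round e kn')) (negPf (g k kn)).
rewrite sum_nat_seq_eq0 => /allP h; rewrite eQ; apply: generic_maximal => // k kn.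
have := h k; rewrite mem_index_iota => /(_ kn) /=.
by case: (_ \is a _).
Qed.

Lemma path_cell_components N w : ground N = [set: 'I_n]%SET ->
  admissible_delannoy U w -> path_cell (base_polytope R N) w ->
  #|components N| = (diagonals w).+1.
Proof.
move=> gN /andP[_ aw] [v [sv eN cv]]; have hN := polytope_weights gN eN.
have [Pv _] := sv.
rewrite (card_components_cuts (ineqs_weighting Pv) _ hN); last first.
  by move=> l; apply: strict_coord.
by rewrite (diagonals_cuts (ltn0Sn 0) (ltn0Sn 0) aw cv) /= big_ltn // psum0 rpred0 add1n.
Qed.

Lemma maximal_series_parallel N : ground N = [set: 'I_n]%SET ->
  maximal_cells subdivision (base_polytope R N) -> series_parallel N.
Proof.
move=> gN /maximal_generic[v [sv eN vg]]; have hN := polytope_weights gN eN.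
have [Pv _] := sv; apply: snake_series_parallel hN; split.
- by move=> l _; apply: strict_coord.
- by apply/set0Pn; exists (Ordinal n_gt0); rewrite inE.
- by case: (ineqs_weighting Pv).
- move=> k l l' _ _ /andP[lk kl']; apply: vg.
  by rewrite (leq_ltn_trans (leq0n l) lk) (leq_ltn_trans kl').
Qed.

End SchubertSubdivision.

Local Open Scope classical_set_scope.

Theorem theorem3p3 (R : realType) (n : nat) (U : {set 'I_n}) :
  0 < n ->
  loopless (schubert U) -> coloopless (schubert U) ->
  exists S : set (set 'rV[R]_n),
    [/\ matroid_subdivision (base_polytope R (schubert U)) S,
        forall N : matroid 'I_n, ground N = [set: 'I_n]%SET ->
          S (base_polytope R N) -> direct_sum_of_series_parallel N,
        forall N : matroid 'I_n, ground N = [set: 'I_n]%SET ->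
          maximal_cells S (base_polytope R N) -> series_parallel N
      & exists phi : set 'rV[R]_n -> seq step,
        [/\ set_bij (internal_faces (base_polytope R (schubert U)) S)
                    [set p | admissible_delannoy U p] phi,
            maximal_cells S `<=`
              internal_faces (base_polytope R (schubert U)) S,
            forall Q, internal_faces (base_polytope R (schubert U)) S Q ->
              (maximal_cells S Q <-> diagonals (phi Q) = 0)
          & forall N : matroid 'I_n, ground N = [set: 'I_n]%SET ->
              internal_faces (base_polytope R (schubert U)) S
                (base_polytope R N) ->
              #|components N| = (diagonals (phi (base_polytope R N))).+1]].
Proof.
move=> n0 ll cl; rewrite schubert_polytope; exists (@subdivision R n U).
split; first exact: subdivision_matroid.
- move=> N gN [v Pv e].
  apply: (weights_series_parallel_sum (ineqs_weighting Pv)).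
  exact: polytope_weights gN e.
- by move=> N; apply: maximal_series_parallel.
have /boolp.choice[phi hphi] : forall Q, exists w,
    internal_faces (@schubert_ineqs R n U) (subdivision U) Q ->
    admissible_delannoy U w /\ path_cell U Q w.
  move=> Q.
  have [iQ|] := pselect (internal_faces (@schubert_ineqs R n U) (subdivision U) Q).
    by have [w aw cw] := internal_path n0 ll cl iQ; exists w.
  (* Sets that are not internal faces get the empty word as default value. *)
  by exists [::].
exists phi; split.
- split.
  + by move=> Q /hphi[].
  + move=> Q Q' /set_mem /hphi[aw cw] /set_mem /hphi[_ cw'] e.
    by rewrite -e in cw'; apply: path_cell_inj aw cw cw'.
  + move=> w aw; have [v sv cv] := delannoy_strict R n0 ll cl aw.
    have iQ := strict_internal sv; exists (cell (@prefix_forms R n) v) => //.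
    have [aw' cw'] := hphi _ iQ.
    apply: (path_cell_fun n0 ll cl aw' aw cw').
    by exists v.
- by move=> Q /(maximal_generic n0 ll cl)[v [sv -> _]]; apply: strict_internal.
- by move=> Q /hphi[aw cw]; exact: (path_cell_maximal n0 ll cl aw cw).
- by move=> N gN /hphi[aw cw]; exact: (path_cell_components n0 gN aw cw).
Qed.
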